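(* There exists an Asplund Banach space $\mathcal{X}$ with a $1$-norming Auerbach basis $\{f_\gamma;\mu_\gamma\}_{\gamma<\omega_1}$ such that $(f_\gamma)_{\gamma<\omega_1}$ is a long monotone Schauder basis of $\mathcal{X}$ and yet $\mathcal{X}$ is not weakly compactly generated.
   Context: Banach spaces are over $\mathbb{R}$ or $\mathbb{C}$ (the result is valid for either scalar field). A Banach space $\mathcal{X}$ is Asplund if every convex continuous function defined on a convex open subset $U$ of $\mathcal{X}$ is Fréchet differentiable on a dense $G_\delta$ subset of $U$ (equivalently, every separable subspace of $\mathcal{X}$ has separable dual). $\mathcal{X}$ is weakly compactly generated (WCG) if it admits a weakly compact subset whose linear span is dense in $\mathcal{X}$. A biorthogonal system in $\mathcal{X}$ is a system $\{x_\gamma;\varphi_\gamma\}_{\gamma\in\Gamma}$ with $x_\gamma\in\mathcal{X}$, $\varphi_\gamma\in\mathcal{X}^*$ and $\langle\varphi_\alpha,x_\beta\rangle=\delta_{\alpha,\beta}$ for all $\alpha,\beta\in\Gamma$. It is a Markuševič basis (M-basis) if $\mathrm{span}\{x_\gamma\}_{\gamma\in\Gamma}$ is norm-dense in $\mathcal{X}$ and $\mathrm{span}\{\varphi_\gamma\}_{\gamma\in\Gamma}$ is $w^*$-dense in $\mathcal{X}^*$. An Auerbach basis is an M-basis with $\|x_\gamma\|=\|\varphi_\gamma\|=1$ for every $\gamma\in\Gamma$. An M-basis is $1$-norming if $$\|x\|\leq\sup\{|\langle\varphi,x\rangle|\colon \varphi\in\mathrm{span}\{\varphi_\gamma\}_{\gamma\in\Gamma},\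 \|\varphi\|\leq 1\}\qquad\text{for all }x\in\mathcal{X}.$$ A family $(e_\gamma)_{\gamma<\Gamma}$ ($\Gamma$ an ordinal) of non-zero vectors is a long basic sequence if and only if there is $C\geq1$ such that $\|y\|\leq C\|y+z\|$ whenever $\Omega<\Gamma$, $y\in\overline{\mathrm{span}}\{e_\gamma\}_{\gamma<\Omega}$ and $z\in\overline{\mathrm{span}}\{e_\gamma\}_{\Omega\leq\gamma<\Gamma}$; in this case the basis constant is at most $C$. It is a long Schauder basis of $\mathcal{X}$ if moreover its linear span is dense in $\mathcal{X}$, and it is monotone if one can take $C=1$. *)

(* Defs.v *)
From HB Require Import structures.
From mathcomp Require Import all_boot all_order all_algebra.
From mathcomp Require Import complex.
From mathcomp Require Import all_classical all_reals all_analysis.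
From mathcomp Require Import borel_hierarchy.
From mathcomp Require wochoice.

Set Implicit Arguments.
Unset Strict Implicit.
Unset Printing Implicit Defensive.

Import Order.TTheory GRing.Theory Num.Theory.
Import numFieldNormedType.Exports.

Local Open Scope classical_set_scope.
Local Open Scope ring_scope.

(* The scalar field is a numFieldType K, to be instantiated with R and with
   R[i] for R : realType.  Norms take values in K; on R[i] the order is the
   partial order in which nonnegative elements are real. *)

Definition is_omega1 (d : Order.disp_t) (I : orderType d) : Prop :=
  [/\ wochoice.well_order (<=%O : rel I),
      ~ countable [set: I]
    & forall a : I, countable [set b : I | (b < a)%O]].

Definition span (K : numFieldType) (V : lmodType K) (A : set V) : set V :=
  [set v | exists (n : nat) (c : 'I_n -> K) (w : 'I_n -> V),
     (forall i, A (w i)) /\ v = \sum_(i < n) c i *: w i].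

Section Banach.
Variables (K : numFieldType) (X : normedModType K).

Definition dual : set (X -> K^o) := [set phi | linear phi /\ continuous phi].

Definition dual_norm (phi : X -> K^o) : K :=
  supremum 0 [set `|phi x| | x in [set x : X | `|x| <= 1]].

Definition evaluation (x : X) : {ptws set_type dual -> K^o} :=
  fun phi => \val phi x.

(* The weak topology is the coarsest topology making every element of the
   dual continuous, i.e. the one induced by evaluation from the product. *)
Definition weakly_compact (A : set X) : Prop :=
  compact (A : set (initial_topology evaluation)).

Definition weakly_compactly_generated : Prop :=
  exists2 A : set X, weakly_compact A & dense (span A).

(* The weak-* topology is the topology of pointwise convergence on X. *)
Definition weak_star_dense (S : set (X -> K^o)) : Prop :=
  dual `<=` closure (S : set {ptws X -> K^o}).

(* Differentiability of a real-valued function is over the reals: the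
   differential L is only required to be R-linear, even when K = R[i]. *)
Definition frechet_differentiable (f : X -> K^o) (x : X) : Prop :=
  exists L : X -> K^o,
    [/\ forall u v, L (u + v) = L u + L v,
        forall (t : K) u, t \is Num.real -> L (t *: u) = t * L u,
        forall u, L u \is Num.real,
        continuous L
      & forall e : K, 0 < e ->
          \forall h \near (0 : X), `|f (x + h) - f x - L h| <= e * `|h|].

(* A real-valued function on U is encoded as f : X -> K taking real values
   on U; its values outside U are irrelevant. *)
Definition asplund : Prop :=
  forall (U : set X) (f : X -> K^o),
    open U -> convex_set U ->
    (forall x, U x -> f x \is Num.real) ->
    convex_function U f -> {within U, continuous f} ->
    exists G : set X,
      [/\ G `<=` U, Gdelta G, U `<=` closure G
        & forall x, G x -> frechet_differentiable f x].

Section Systems.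
Variables (I : eqType) (x_ : I -> X) (phi_ : I -> X -> K^o).

Definition biorthogonal : Prop :=
  (forall i, dual (phi_ i)) /\ (forall i j, phi_ i (x_ j) = (i == j)%:R).

Definition markushevich_basis : Prop :=
  [/\ biorthogonal, dense (span (range x_))
    & weak_star_dense (span (range phi_))].

Definition auerbach_basis : Prop :=
  markushevich_basis /\ forall i, `|x_ i| = 1 /\ dual_norm (phi_ i) = 1.

Definition one_norming : Prop :=
  forall x : X, `|x| <=
    supremum 0 [set `|phi x| | phi in
                  [set phi | span (range phi_) phi /\ dual_norm phi <= 1]].

End Systems.

Section LongBases.
Variables (d : Order.disp_t) (I : orderType d) (e_ : I -> X).

Definition basis_constant_le (C : K) : Prop :=
  forall (a : I) (y z : X),
    closure (span (e_ @` [set i | (i < a)%O])) y ->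
    closure (span (e_ @` [set i | (a <= i)%O])) z ->
    `|y| <= C * `|y + z|.

Definition long_basic_sequence : Prop :=
  (forall i, e_ i != 0) /\ exists2 C : K, 1 <= C & basis_constant_le C.

Definition long_schauder_basis : Prop :=
  long_basic_sequence /\ dense (span (range e_)).

Definition monotone_long_schauder_basis : Prop :=
  long_schauder_basis /\ basis_constant_le 1.

End LongBases.

End Banach.

(* Main.v *)
Require Import Defs.
From HB Require Import structures.
From mathcomp Require Import all_boot all_order all_algebra.
From mathcomp Require Import complex ring lra zify.
From mathcomp Require Import all_classical all_reals all_analysis.
From mathcomp Require wochoice.

Set Implicit Arguments.
Unset Strict Implicit.
Unset Printing Implicit Defensive.

Import Order.TTheory GRing.Theory Num.Theory.
Import numFieldNormedType.Exports.

Local Open Scope classical_set_scope.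
Local Open Scope ring_scope.

(** The space is spanned, in the sup norm, by the coordinate functions
    [f_i A = 1 if i in A, else 0] on a compact family of subsets [A] of the first
    uncountable ordinal. The family consists of finite sets [F b n] (for [b] an
    ordinal and [n] a natural number) together with all initial segments, and its
    combinatorics is that of a subadditive function: [F b n] has maximum [b],
    increases with [n] to the segment up to [b], has at most [n + 1] elements, and
    is coherent, i.e. [c] in [F b n] implies that [F c n] is the part of [F b n] up
    to [c]. Such sets are built by transfinite recursion ([exists_coherent]),
    following a cofinal sequence below [b] slowly enough.

    The basis properties are read off the family. Singletons are the sets [F b 0],
    so the evaluations there are the biorthogonal functionals, of norm one. The
    sets [F b n] are dense, so their evaluations, which are finite sums of
    biorthogonal functionals, norm the space. The family is stable under
    intersection with initial segments, so the basis is monotone.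

    The space is not weakly compactly generated ([not_wcg]). Each element is
    decided by countably many memberships, so the partial sum functionals
    (evaluations at initial segments) converge pointwise to the total sum. If a
    weakly compact set generated the space, compactness of its finite powers
    would put the total sum in the closure of countably many partial sums, which
    all vanish on a basis vector of larger index.

    The space is Asplund because the family is closed ([pset_closed]) and has
    only countably many traces on a countable ordinal: a limit of sets [F b n]
    that is not an initial segment involves boundedly many [n] and hence is
    finite. A bounded functional on the continuous functions of a countable
    compact space is, up to small norm, a finite combination of evaluations
    ([atomic_approx]), so separable pieces of the space have separable duals
    ([separable_dual]). Finally, for a convex continuous [g] and [e > 0], the balls in
    which the second differences of [g] are at most [e * |h|] have a dense union
    ([good_ball_dense]): otherwise some separable piece would contain witnesses of
    failure around each of its points, and nested balls could be chosen to defeat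
    a dense sequence of functionals as subgradients, leaving a point without
    subgradient. At a point lying in such balls for every [e], a subgradient is a
    Frechet derivative.

    Both scalar fields are treated at once through their real and imaginary
    parts; convexity and differentiability concern the underlying real space. *)

Section SublinearMinorant.
Variables (R : realType) (V : lmodType R).

Definition sublinear (p : V -> R) : Prop :=
  (forall x y, p (x + y) <= p x + p y) /\
  (forall (t : R) x, 0 < t -> p (t *: x) = t * p x).

Lemma sublinear0 p : sublinear p -> p 0 = 0.
Proof.
move=> [_ hom]; have := hom 2 0 (ltr0Sn _ _); rewrite scaler0 => h.
by lra.
Qed.

Lemma sublinear_geN p x : sublinear p -> - p (- x) <= p x.
Proof.
move=> sp; have := sp.1 x (- x); rewrite subrr (sublinear0 sp); lra.
Qed.

Lemma sublinear_ge0Z p (t : R) x : sublinear p -> 0 <= t ->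
  p (t *: x) = t * p x.
Proof.
move=> sp; rewrite le_eqVlt => /predU1P[<-|/(sp.2)//].
by rewrite scale0r mul0r sublinear0.
Qed.

(** Zorn's lemma applies because a sublinear [q <= p] is bounded below by
    [- p (- x)], so pointwise infima of chains are finite. *)
Lemma sublinear_minimal p : sublinear p ->
  exists q, [/\ sublinear q, forall x, q x <= p x &
    forall r, sublinear r -> (forall x, r x <= q x) -> r = q].
Proof.
move=> sp.
pose T := {q : V -> R | sublinear q /\ forall x, q x <= p x}.
pose le (q r : T) : bool := `[< forall x, sval r x <= sval q x >].
case: (@Zorn T le).
- by move=> q; apply/asboolP => x.
- move=> a b c /asboolP ab /asboolP bc; apply/asboolP => x.
  exact: le_trans (bc x) (ab x).
- move=> [a pa] [b pb] /asboolP ab /asboolP ba; apply: eq_exist; apply: funext => x.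
  by apply: le_anti; rewrite (ab x) (ba x).
- move=> A totA; have [[q0 Aq0]|nA] := pselect (exists q, A q); last first.
    by exists (exist _ p (conj sp (fun x => lexx _))) => s As; case: nA; exists s.
  pose v x := [set sval q x | q in A].
  have vlb x : has_inf (v x).
    split; first by exists (sval q0 x), q0.
    exists (- p (- x)) => _ [q Aq <-].
    have [sq qp] := svalP q.
    by have := sublinear_geN x sq; have := qp (- x); lra.
  pose m x := inf (v x).
  have mle q x : A q -> m x <= sval q x.
    by move=> Aq; apply: ge_inf; [exact: (vlb x).2|exists q].
  have mge x c : (forall q, A q -> c <= sval q x) -> c <= m x.
    move=> h; apply: lb_le_inf; first exact: (vlb x).1.
    by move=> _ [q Aq <-]; exact: h.
  have sm : sublinear m.
    split.
      move=> x y; rewrite -lerBlDr; apply: (mge) => q Aq.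
      rewrite lerBlDr -lerBlDl; apply: (mge) => r Ar.
      rewrite lerBlDl.
      have [/asboolP qr|/asboolP rq] := totA _ _ Aq Ar.
        apply: le_trans (mle r _ Ar) _; apply: le_trans ((svalP r).1.1 x y) _.
        by rewrite lerD2r; exact: qr.
      apply: le_trans (mle q _ Aq) _; apply: le_trans ((svalP q).1.1 x y) _.
      by rewrite lerD2l; exact: rq.
    move=> t x t0; apply: le_anti; apply/andP; split.
      rewrite -ler_pdivrMl//; apply: (mge) => q Aq.
      by rewrite ler_pdivrMl// -((svalP q).1.2 _ _ t0); exact: mle.
    apply: (mge) => q Aq.
    by rewrite ((svalP q).1.2 _ _ t0) ler_pM2l//; exact: mle.
  have mp x : m x <= p x by apply: le_trans (mle _ _ Aq0) _; exact: (svalP q0).2.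
  exists (exist _ m (conj sm mp)) => q Aq; apply/asboolP => x; exact: mle.
move=> [q [sq qp]] /= qmin; exists q; split => // r sr rq.
have rp x : r x <= p x by exact: le_trans (rq x) (qp x).
have := qmin (exist _ r (conj sr rp)) (introT (asboolP _) rq).
by move=> [->].
Qed.

(** The Hahn-Banach theorem, through minimality: for a minimal [q] the sublinear
    functional [x |-> inf_t (q (x + t y) - t q y)] lies below [q], hence equals it,
    which makes [q] superadditive. *)
Lemma sublinear_linear_minorant p : sublinear p ->
  exists L : V -> R, [/\ forall x y, L (x + y) = L x + L y,
    forall (t : R) x, L (t *: x) = t * L x & forall x, L x <= p x].
Proof.
move=> /sublinear_minimal[q [sq qp qmin]].
have superadd x y : q x + q y <= q (x + y).
  pose v z := [set q (z + t *: y) - t * q y | t in [set t : R | 0 <= t]].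
  have vlb z c : v z c -> - q (- z) <= c.
    move=> [t t0 <-]; have := sq.1 (z + t *: y) (- z).
    rewrite addrC addKr (sublinear_ge0Z _ sq t0); lra.
  have vinf z : has_inf (v z).
    split; last by exists (- q (- z)) => c; exact: vlb.
    by exists (q z); exists 0 => //=; rewrite scale0r addr0 mul0r subr0.
  pose m z := inf (v z).
  have mle z t : 0 <= t -> m z <= q (z + t *: y) - t * q y.
    by move=> t0; apply: ge_inf; [exact: (vinf z).2|exists t].
  have mge z c : (forall t, 0 <= t -> c <= q (z + t *: y) - t * q y) -> c <= m z.
    move=> h; apply: lb_le_inf; first exact: (vinf z).1.
    by move=> _ [t t0 <-]; exact: h.
  have mq z : m z <= q z.
    by apply: le_trans (mle z 0 (lexx _)) _; rewrite scale0r addr0 mul0r subr0.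
  have sm : sublinear m.
    split.
      move=> a b; rewrite -lerBlDr; apply: (mge) => t t0.
      rewrite lerBlDr -lerBlDl; apply: (mge) => s s0.
      rewrite lerBlDl; apply: le_trans (mle _ (t + s) (addr_ge0 t0 s0)) _.
      have -> : a + b + (t + s) *: y = (a + t *: y) + (b + s *: y).
        by rewrite scalerDl addrACA.
      have := sq.1 (a + t *: y) (b + s *: y); lra.
    move=> t z t0; apply: le_anti; apply/andP; split.
      rewrite -ler_pdivrMl//; apply: (mge) => s s0.
      rewrite ler_pdivrMl//; apply: le_trans (mle _ (t * s) _) _.
        by rewrite mulr_ge0// ltW.
      by rewrite -scalerA -scalerDr (sq.2 _ _ t0) mulrBr mulrA.
    apply: (mge) => s s0; rewrite -ler_pdivlMl//; apply: le_trans (mle _ (t^-1 * s) _) _.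
      by rewrite mulr_ge0// invr_ge0 ltW.
    rewrite ler_pdivlMl// mulrBr -(sq.2 _ _ t0) scalerDr !scalerA.
    by rewrite !mulrA mulfV ?gt_eqF// !mul1r.
  have e := qmin _ sm mq; have := mle x 1 ler01; rewrite e scale1r; lra.
have add x y : q (x + y) = q x + q y.
  by apply: le_anti; rewrite sq.1 superadd.
have opp x : q (- x) = - q x.
  by have := add x (- x); rewrite subrr (sublinear0 sq); lra.
exists q; split => // t x; have [t0|t0] := lerP 0 t.
  exact: sublinear_ge0Z.
have := sublinear_ge0Z (- x) sq (_ : 0 <= - t).
by rewrite scaleNr scalerN opprK opp mulrNN => ->//; rewrite oppr_ge0 ltW.
Qed.
End SublinearMinorant.

(** * Real and complex scalars *)

(** What is used of the scalar field: the embedding [emb] of the reals, real and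
    imaginary parts, and the imaginary unit [imag]. The real field fits with
    [im] and [imag] equal to zero. *)
Record scalars (R : realType) (K : numFieldType) := Scalars {
  emb : {rmorphism R -> K};
  re : {additive K -> R};
  im : {additive K -> R};
  imag : K;
  emb_le : {mono emb : x y / x <= y};
  re1 : re 1 = 1;
  re_embM : forall r z, re (emb r * z) = r * re z;
  im_embM : forall r z, im (emb r * z) = r * im z;
  emb_re : forall z, 0 <= z -> emb (re z) = z;
  scalarE : forall z, z = emb (re z) + imag * emb (im z);
  imag_le1 : `|imag| <= 1;
  re_le : forall z, `|re z| <= re `|z|;
  im_le : forall z, `|im z| <= re `|z| }.

Section Modulus.
Variables (R : realType) (K : numFieldType) (S : scalars R K).

Definition modulus (z : K) : R := re S `|z|.
Local Notation N := modulus.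

Lemma emb_modulus z : emb S (N z) = `|z|.
Proof. by rewrite emb_re. Qed.

Lemma re_emb r : re S (emb S r) = r.
Proof. by rewrite -[emb S r]mulr1 re_embM re1 mulr1. Qed.

Lemma re_homo : {homo re S : x y / x <= y}.
Proof.
move=> x y; rewrite -subr_ge0 => xy.
by rewrite -subr_ge0 -raddfB -(emb_le S) emb_re// rmorph0.
Qed.

Lemma modulus_ge0 z : 0 <= N z.
Proof. by rewrite -[0](raddf0 (re S)) re_homo. Qed.

Lemma emb_ge0 r : (0 <= emb S r) = (0 <= r).
Proof. by rewrite -[in LHS](rmorph0 (emb S)) emb_le. Qed.

Lemma emb_lt : {mono emb S : x y / x < y}.
Proof. exact: leW_mono (emb_le S). Qed.

Lemma emb_gt0 r : (0 < emb S r) = (0 < r).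
Proof. by rewrite -[in LHS](rmorph0 (emb S)) emb_lt. Qed.

Lemma modulusM x y : N (x * y) = N x * N y.
Proof. by rewrite /N normrM -{1}emb_modulus re_embM. Qed.

Lemma modulus_emb r : N (emb S r) = `|r|.
Proof.
rewrite /N; have [r0|r0] := lerP 0 r.
  by rewrite !ger0_norm ?emb_ge0// re_emb.
rewrite (ltr0_norm r0) -[X in `|X|]opprK normrN -rmorphN.
by rewrite ger0_norm ?emb_ge0 ?oppr_ge0 1?ltW// re_emb.
Qed.

Lemma modulusD x y : N (x + y) <= N x + N y.
Proof. by rewrite -raddfD re_homo// ler_normD. Qed.

Lemma modulusN x : N (- x) = N x.
Proof. by rewrite /N normrN. Qed.

Lemma modulus0 : N 0 = 0.
Proof. by rewrite /N normr0 raddf0. Qed.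

Lemma modulus1 : N 1 = 1.
Proof. by rewrite /N normr1 re1. Qed.

Lemma modulus_eq0 z : N z = 0 -> z = 0.
Proof.
by move=> z0; apply/eqP; rewrite -normr_eq0 -emb_modulus z0 rmorph0.
Qed.

Lemma modulusB x y : N (x - y) = N (y - x).
Proof. by rewrite /N distrC. Qed.

Lemma modulus_le_reim z : N z <= `|re S z| + `|im S z|.
Proof.
rewrite {1}[z](scalarE S) (le_trans (modulusD _ _))// modulus_emb lerD2l.
rewrite modulusM modulus_emb ler_piMl// -(re1 S); apply: re_homo; exact: imag_le1.
Qed.

Lemma real_emb z : z \is Num.real -> emb S (re S z) = z.
Proof.
rewrite realE => /orP[/emb_re//|z0].
by rewrite -[z]opprK raddfN rmorphN emb_re// oppr_ge0.
Qed.

Lemma emb_real r : emb S r \is Num.real.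
Proof. by rewrite realE -(rmorph0 (emb S)) !emb_le le_total. Qed.

Lemma modulus_le z r : (N z <= r) = (`|z| <= emb S r).
Proof. by rewrite -emb_modulus emb_le. Qed.

Lemma modulus_sum (I : Type) (s : seq I) (P : pred I) (F : I -> K) :
  N (\sum_(i <- s | P i) F i) <= \sum_(i <- s | P i) N (F i).
Proof.
elim/big_ind2 : _ => [|x a y b xa yb|//]; first by rewrite modulus0.
by rewrite (le_trans (modulusD _ _))// lerD.
Qed.

End Modulus.

(** * Uniformly closed spaces of bounded functions *)

Section UniformSpace.
Variables (R : realType) (K : numFieldType) (S : scalars R K) (T : Type).
Local Notation N := (modulus S).

Record uspace := USpace {
  usmem : set (T -> K);
  us0 : usmem (fun=> 0);
  usZD : forall a x y, usmem x -> usmem y -> usmem (fun t => a * x t + y t);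
  usbounded : forall x, usmem x -> exists M, forall t, N (x t) <= M;
  usclosed : forall x, (forall e, 0 < e ->
    exists2 y, usmem y & forall t, N (x t - y t) <= e) -> usmem x }.

Variable E : uspace.

Definition uspred : {pred (T -> K)} := fun x => `[< usmem E x >].

Record uelt := UElt { ufun :> T -> K; _ : ufun \in uspred }.
HB.instance Definition _ := [isSub for ufun].
HB.instance Definition _ := [Choice of uelt by <:].

Lemma uspred_submod : GRing.submod_closed uspred.
Proof.
split; first by apply/asboolP; exact: us0.
by move=> a x y /asboolP Ex /asboolP Ey; apply/asboolP; exact: usZD.
Qed.
HB.instance Definition _ :=
  GRing.isSubmodClosed.Build K (T -> K) uspred uspred_submod.
HB.instance Definition _ := [SubChoice_isSubLmodule of uelt by <:].

Lemma ueltP (x : uelt) : usmem E x.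
Proof. by have /asboolP := valP x. Qed.

Lemma uelt_eqP (x y : uelt) : (forall t, x t = y t) -> x = y.
Proof. by move=> xy; apply: val_inj; apply: funext. Qed.

Lemma ufunD (x y : uelt) t : (x + y) t = x t + y t. Proof. by []. Qed.
Lemma ufunN (x : uelt) t : (- x) t = - x t. Proof. by []. Qed.
Lemma ufunB (x y : uelt) t : (x - y) t = x t - y t. Proof. by []. Qed.
Lemma ufunZ a (x : uelt) t : (a *: x) t = a * x t. Proof. by []. Qed.
Lemma ufun0 t : (0 : uelt) t = 0. Proof. by []. Qed.
Lemma ufun_sum (I : Type) (s : seq I) (P : pred I) (F : I -> uelt) t :
  (\sum_(i <- s | P i) F i) t = \sum_(i <- s | P i) F i t.
Proof. by elim/big_ind2 : _ => // x a y b <- <-. Qed.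

Implicit Types x y : uelt.

(** The norm as a real number; [0] is added to the set so that an empty [T] does
    not matter. *)
Definition supn (x : uelt) : R := sup [set r | r = 0 \/ exists t, r = N (x t)].

Lemma supn_has_sup x : has_sup [set r | r = 0 \/ exists t, r = N (x t)].
Proof.
have [M xM] := usbounded (ueltP x).
split; first by exists 0; left.
exists `|M| => r [->|[t ->]]; first exact: normr_ge0.
by rewrite (le_trans (xM t))// ler_norm.
Qed.

Lemma supn_ge x t : N (x t) <= supn x.
Proof. by apply: sup_ubound; [exact: (supn_has_sup x).2|right; exists t]. Qed.

Lemma supn_ge0 x : 0 <= supn x.
Proof. by apply: sup_ubound; [exact: (supn_has_sup x).2|left]. Qed.

Lemma supn_le x M : 0 <= M -> (forall t, N (x t) <= M) -> supn x <= M.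
Proof.
move=> M0 xM; apply: ge_sup; first exact: (supn_has_sup x).1.
by move=> r [->//|[t ->]].
Qed.

Lemma supnD x y : supn (x + y) <= supn x + supn y.
Proof.
apply: supn_le => [|t]; first by rewrite addr_ge0 ?supn_ge0.
by rewrite ufunD (le_trans (modulusD _ _ _))// lerD// supn_ge.
Qed.

Lemma supnZ a x : supn (a *: x) = N a * supn x.
Proof.
have le b y : supn (b *: y) <= N b * supn y.
  apply: supn_le => [|t]; first by rewrite mulr_ge0 ?supn_ge0 ?modulus_ge0.
  by rewrite ufunZ modulusM ler_wpM2l ?modulus_ge0 ?supn_ge.
apply: le_anti; rewrite le/=; have [->|a0] := eqVneq a 0.
  by rewrite modulus0 mul0r supn_ge0.
have Na : 0 < N a.
  rewrite lt_neqAle modulus_ge0 andbT eq_sym; apply: contra_neq a0.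
  exact: modulus_eq0.
have NV : N a^-1 = (N a)^-1.
  by apply: (mulfI (negbT (gt_eqF Na))); rewrite -modulusM mulfV// modulus1 mulfV ?gt_eqF.
rewrite -ler_pdivlMl// -NV; have := le a^-1 (a *: x).
by rewrite scalerA mulVf// scale1r.
Qed.

Lemma supn0_eq0 x : supn x = 0 -> x = 0.
Proof.
move=> x0; apply: uelt_eqP => t; apply: (@modulus_eq0 _ _ S); apply: le_anti.
by rewrite modulus_ge0 andbT -x0 supn_ge.
Qed.

Fact unormD (x y : uelt) : emb S (supn (x + y)) <= emb S (supn x) + emb S (supn y).
Proof. by rewrite -rmorphD emb_le supnD. Qed.

Fact unormZ a (x : uelt) : emb S (supn (a *: x)) = `|a| * emb S (supn x).
Proof. by rewrite supnZ rmorphM emb_modulus. Qed.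

Fact unorm0_eq0 (x : uelt) : emb S (supn x) = 0 -> x = 0.
Proof.
by move=> /(congr1 (re S)); rewrite re_emb raddf0 => /supn0_eq0.
Qed.

HB.instance Definition _ :=
  @Lmodule_isNormed.Build K uelt (fun x => emb S (supn x)) unormD unormZ unorm0_eq0.

Lemma unormE (x : uelt) : `|x| = emb S (supn x). Proof. by []. Qed.

Lemma re_unorm (x : uelt) : re S `|x| = supn x.
Proof. by rewrite unormE re_emb. Qed.

Lemma supnN x : supn (- x) = supn x.
Proof. by rewrite -scaleN1r supnZ modulusN modulus1 mul1r. Qed.

Lemma supnC x y : supn (x - y) = supn (y - x).
Proof. by rewrite -supnN opprB. Qed.

Lemma ubounded_cauchy_lim (a c : nat -> R) :
  (forall n m, (n <= m)%N -> `|a n - a m| <= c n) ->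
  exists l, forall n, `|a n - l| <= c n.
Proof.
move=> ac; have c0 n : 0 <= c n by rewrite (le_trans _ (ac n n _)).
have lohi n m : a n - c n <= a m + c m.
  have [nm|/ltnW mn] := leqP n m.
    by have := ac _ _ nm; have := c0 m; rewrite ler_norml => ? /andP[]; lra.
  by have := ac _ _ mn; have := c0 n; rewrite ler_norml => ? /andP[]; lra.
have hs : has_sup [set a n - c n | n in [set: nat]].
  split; first by exists (a 0%N - c 0%N), 0%N.
  by exists (a 0%N + c 0%N) => _ [n _ <-].
exists (sup [set a n - c n | n in [set: nat]]) => n.
have h1 : a n - c n <= sup [set a n - c n | n in [set: nat]].
  by apply: sup_ubound; [exact: hs.2|exists n].
have h2 : sup [set a n - c n | n in [set: nat]] <= a n + c n.
  by apply: ge_sup; [exact: hs.1|move=> _ [m _ <-]].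
rewrite ler_norml; lra.
Qed.

Lemma useq_complete (u : nat -> uelt) (c : nat -> R) :
  (forall e, 0 < e -> exists n, c n <= e) ->
  (forall n m, (n <= m)%N -> supn (u n - u m) <= c n) ->
  exists l, forall n, supn (u n - l) <= 2 * c n.
Proof.
move=> c_small uc.
have c0 n : 0 <= c n by rewrite (le_trans (supn_ge0 _) (uc n n _)).
have reC t : exists l, forall n, `|re S (u n t) - l| <= c n.
  apply: ubounded_cauchy_lim => n m nm; rewrite -raddfB -ufunB.
  by rewrite (le_trans (re_le _ _))// (le_trans _ (uc _ _ nm))// supn_ge.
have imC t : exists l, forall n, `|im S (u n t) - l| <= c n.
  apply: ubounded_cauchy_lim => n m nm; rewrite -raddfB -ufunB.
  by rewrite (le_trans (im_le _ _))// (le_trans _ (uc _ _ nm))// supn_ge.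
have [a Ha] := choice reC; have [b Hb] := choice imC.
pose l t := emb S (a t) + imag S * emb S (b t).
have lim n t : N (u n t - l t) <= 2 * c n.
  rewrite [u n t](scalarE S) /l opprD addrACA -mulrBr -!rmorphB.
  rewrite (le_trans (modulusD _ _ _))// modulusM !modulus_emb.
  rewrite mulr_natl mulr2n lerD// -[leRHS]mul1r ler_pM ?modulus_ge0//.
  by rewrite -(re1 S) re_homo// imag_le1.
have El : l \in uspred.
  apply/asboolP; apply: usclosed => e e0.
  have [n cn] := c_small _ (divr_gt0 e0 (ltr0Sn _ 1)).
  exists (u n); first exact: ueltP.
  by move=> t; rewrite modulusB (le_trans (lim n t))//; lra.
exists (UElt El) => n; apply: supn_le => [|t]; first by rewrite mulr_ge0.
by rewrite ufunB lim.
Qed.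

Lemma uelt_complete (F : set_system uelt) : ProperFilter F -> cauchy F -> cvg F.
Proof.
move=> PF /cauchyP cF.
pose c (n : nat) : R := n.+1%:R^-1.
have c_gt0 n : 0 < c n by rewrite invr_gt0.
have /choice[x Fx] : forall n, exists x : uelt, F (ball x (emb S (c n))).
  by move=> n; apply: cF; rewrite emb_gt0.
have c_small e : 0 < e -> exists n, 2 * c n <= e.
  move=> e0; exists (Num.truncn (2 / e)).
  by rewrite /c ler_pdivrMr// mulrC -ler_pdivrMr// ltW// truncnS_gt.
have ballE (y z : uelt) r : ball y (emb S r) z -> supn (y - z) < r.
  by rewrite -ball_normE /ball_/= unormE emb_lt.
have [l Hl] : exists l, forall n, supn (x n - l) <= 2 * (2 * c n).
  apply: useq_complete => // n m nm.
  have [y [/ballE xny /ballE xmy]] := filter_ex (filterI (Fx n) (Fx m)).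
  have -> : x n - x m = (x n - y) + (y - x m) by rewrite addrA subrK.
  rewrite (le_trans (supnD _ _))// mulr_natl mulr2n lerD 1?ltW//.
  have cmn : c m <= c n by rewrite lef_pV2 ?posrE// ler_nat.
  by apply: lt_le_trans cmn; rewrite supnC.
apply/cvg_ex; exists l; apply/cvg_ballP => e e0.
have [n cn] : exists n, 2 * c n <= re S e / 4.
  by apply: c_small; rewrite divr_gt0// -(emb_gt0 S) emb_re// ltW.
near=> y; rewrite -ball_normE /ball_/= unormE -(emb_re S (ltW e0)) emb_lt.
have /ballE xy : ball (x n) (emb S (c n)) y by near: y; exact: Fx.
have -> : l - y = (x n - y) - (x n - l) by rewrite opprB [RHS]addrC addrA subrK.
rewrite (le_lt_trans (supnD _ _))//.
rewrite supnN.
by have := Hl n; have := c_gt0 n; lra.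
Unshelve. all: by end_near. Qed.

HB.instance Definition _ := Uniform_isComplete.Build uelt uelt_complete.

End UniformSpace.

(** * Coherent finite sets in a well-order with countable initial segments *)

Lemma countable_enum (T : Type) (A : set T) x0 : countable A -> A x0 ->
  exists a : nat -> T, (forall n, A (a n)) /\ forall x, A x -> exists n, a n = x.
Proof.
move=> /countable_injP[f finj] Ax0.
have /choice[a Ha] : forall n, exists y, A y /\ forall x, A x -> f x = n -> y = x.
  move=> n; have [[x [Ax fx]]|no] := pselect (exists x, A x /\ f x = n).
    exists x; split => // y Ay fy; apply: finj; rewrite ?inE//.
    by rewrite fx fy.
  by exists x0; split => // x Ax fx; case: no; exists x.
exists a; split => [n|x Ax]; first exact: (Ha n).1.
by exists (f x); apply: (Ha (f x)).2.
Qed.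

Section CoherentFamily.
Variables (d : Order.disp_t) (I : orderType d).
Hypothesis lt_wf : well_founded (fun a b : I => (a < b)%O).
Hypothesis countable_below : forall a : I, countable [set b : I | (b < a)%O].
Implicit Types (a b x : I) (F : I -> nat -> seq I) (n m k : nat).

(** The sets [phi n] attached to [a] extend those of smaller points: [phi n] is a
    previous set [F b n], with [b = eta n], followed by [a]. The condition [coh_step]
    makes [phi] increasing and [coh_cofinal] makes it exhaust the points below [a].
    The slack between [size (phi n)] and [n] is what allows the construction to add
    one element at the next point without violating [coh_size]. *)
Record coherent_at F a (phi : nat -> seq I) (eta : nat -> option I) : Prop :=
  CoherentAt {
  coh_def : forall n, phi n = if eta n is Some b then rcons (F b n) a else [:: a];
  coh_lt : forall n b, eta n = Some b -> (b < a)%O;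
  coh_step : forall n b, eta n = Some b ->
    exists2 b', eta n.+1 = Some b' & b \in F b' n.+1;
  coh_cofinal : forall x, (x < a)%O -> exists n b, eta n = Some b /\ (x <= b)%O;
  coh_size : forall n, (size (phi n) <= n.+1)%N;
  coh_slack : forall k, exists N, forall n, (N <= n)%N -> (size (phi n) + k <= n)%N
}.

Definition coherent F a phi := exists eta, coherent_at F a phi eta.

Lemma eq_coherent F F' a phi : (forall b, (b < a)%O -> F b = F' b) ->
  coherent F a phi -> coherent F' a phi.
Proof.
move=> FF' [eta [h1 h2 h3 h4 h5 h6]]; exists eta; split => // n.
  by rewrite h1; case e : (eta n) => [b|//]; rewrite FF'//; exact: h2 e.
move=> b e; have [b' e' bb'] := h3 _ _ e.
by exists b' => //; rewrite -FF'//; exact: h2 e'.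
Qed.

Section Facts.
Variable F : I -> nat -> seq I.

Lemma coh_le b n x : (forall c, (c <= b)%O -> coherent F c (F c)) ->
  x \in F b n -> (x <= b)%O.
Proof.
elim/(well_founded_ind lt_wf) : b x => b IH x cF; have [eta e] := cF _ (lexx b).
rewrite (coh_def e); case en : (eta n) => [c|]; last first.
  by rewrite inE => /eqP->.
have cb := coh_lt e en; rewrite mem_rcons inE => /predU1P[->//|/IH].
move=> /(_ cb) h; rewrite (le_trans (h _)) ?ltW// => y yc.
by apply: cF; rewrite (le_trans yc)// ltW.
Qed.

Lemma coh_self b n : coherent F b (F b) -> b \in F b n.
Proof.
move=> [eta e]; rewrite (coh_def e); case: (eta n) => [c|]; last exact: mem_head.
by rewrite mem_rcons mem_head.
Qed.

Lemma coh_filter b n x : (forall c, (c <= b)%O -> coherent F c (F c)) ->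
  x \in F b n -> F x n = [seq y <- F b n | (y <= x)%O].
Proof.
elim/(well_founded_ind lt_wf) : b x => b IH x cF; have [eta e] := cF _ (lexx b).
have [-> _|xb] := eqVneq x b.
  by rewrite (@eq_in_filter _ _ predT) ?filter_predT// => y /coh_le ->.
rewrite (coh_def e); case en : (eta n) => [c|]; last by rewrite inE (negbTE xb).
have cb := coh_lt e en; rewrite mem_rcons inE (negbTE xb)/= => xc.
have cF' y : (y <= c)%O -> coherent F y (F y).
  by move=> yc; apply: cF; rewrite (le_trans yc)// ltW.
rewrite filter_rcons (IH _ cb)// ifN// -ltNge.
by rewrite (le_lt_trans _ cb)// (coh_le _ xc).
Qed.

Lemma coh_trans b n x y : (forall c, (c <= b)%O -> coherent F c (F c)) ->
  x \in F b n -> y \in F x n -> y \in F b n.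
Proof. by move=> cF xb; rewrite (coh_filter cF xb) mem_filter => /andP[]. Qed.

Lemma coh_monoS b n x : (forall c, (c <= b)%O -> coherent F c (F c)) ->
  x \in F b n -> x \in F b n.+1.
Proof.
elim/(well_founded_ind lt_wf) : b x => b IH x cF; have [eta e] := cF _ (lexx b).
have [-> _|xb] := eqVneq x b; first exact: coh_self (cF _ _).
rewrite (coh_def e); case en : (eta n) => [c|]; last by rewrite inE (negbTE xb).
have cb := coh_lt e en; rewrite mem_rcons inE (negbTE xb)/= => xc.
have [c' en' cc'] := coh_step e en; have c'b := coh_lt e en'.
rewrite (coh_def e) en' mem_rcons inE (negbTE xb)/=.
have cF' z y : (z < b)%O -> (y <= z)%O -> coherent F y (F y).
  by move=> zb yc; apply: cF; rewrite (le_trans yc)// ltW.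
apply: (coh_trans _ cc'); first by move=> y; exact: cF'.
by apply: IH => // y; exact: cF'.
Qed.

(** The branches [F (eta n) n] grow along [n] and contain every [eta m], [m <= n];
    the latter are cofinal, so induction applies below one of them. *)
Lemma coh_exhaust b x : (forall c, (c <= b)%O -> coherent F c (F c)) ->
  (x <= b)%O -> exists N, forall n, (N <= n)%N -> x \in F b n.
Proof.
elim/(well_founded_ind lt_wf) : b x => b IH x cF; have [eta e] := cF _ (lexx b).
rewrite le_eqVlt => /predU1P[->|xb].
  by exists 0%N => n _; exact: coh_self (cF _ _).
have [n [c [en xc]]] := coh_cofinal e xb.
have cF' z y : (z < b)%O -> (y <= z)%O -> coherent F y (F y).
  by move=> zb yc; apply: cF; rewrite (le_trans yc)// ltW.
have cb := coh_lt e en.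
have later k : exists2 c', eta (n + k)%N = Some c' & c \in F c' (n + k)%N.
  elim: k => [|k [c' e1 e2]]; first by exists c; rewrite addn0//; apply: coh_self; exact: cF' (lexx _).
  have [c'' e3 e4] := coh_step e e1; exists c''; rewrite addnS//.
  have h := coh_lt e e1; have h' := coh_lt e e3.
  apply: (coh_trans _ e4); first by move=> y; exact: cF'.
  by apply: coh_monoS => // y; exact: cF'.
have [N HN] := IH _ cb x (fun y => cF' _ y cb) xc.
exists (maxn N n) => m; rewrite geq_max => /andP[Nm nm].
have [c' e1 e2] := later (m - n)%N; rewrite subnKC// in e1 e2.
have h := coh_lt e e1.
rewrite (coh_def e) e1 mem_rcons inE (coh_trans _ e2 (HN _ Nm)) ?orbT//.
by move=> y; exact: cF'.
Qed.

(** A sequence [g] increasing to [a] is followed slowly: [g k] is in use at stage [n]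
    only once [g (k - 1)] belongs to [F (g k) n] and [F (g k) n] has fewer than [n - k]
    elements. *)
Lemma coherent_ext a : (forall b, (b < a)%O -> coherent F b (F b)) ->
  exists phi, coherent F a phi.
Proof.
move=> cF; have [[x0 x0a]|no] := pselect (exists x, (x < a)%O); last first.
  exists (fun=> [:: a]), (fun=> None); split => //.
    by move=> x xa; case: no; exists x.
  by move=> k; exists k.+1.
have [u [ua usurj]] := countable_enum (countable_below a) x0a.
pose g := fix g k := if k is k'.+1 then Order.max (g k') (u k) else u 0%N.
have ga k : (g k < a)%O by elim: k => [|k IH] /=; rewrite ?gt_max ?IH; exact: ua.
have gS k : (g k <= g k.+1)%O by rewrite /= le_max lexx.
have gmono k m : (k <= m)%N -> (g k <= g m)%O.
  move=> /subnKC <-; elim: (m - k)%N => [|j IH]; first by rewrite addn0.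
  by rewrite addnS (le_trans IH).
have ug k : (u k <= g k)%O by case: k => [|k] /=; rewrite ?le_max lexx ?orbT.
have cF' z y : (z < a)%O -> (y <= z)%O -> coherent F y (F y).
  by move=> zb yc; apply: cF; rewrite (le_lt_trans yc).
pose Q k n := (size (F (g k) n) + k < n)%N /\ (g k.-1 \in F (g k) n).
have /choice[M HM] : forall k, exists M, forall n, (M <= n)%N -> Q k n.
  move=> k; have [eta e] := cF _ (ga k).
  have [N HN] := coh_slack e k.+1.
  have gk1 : (g k.-1 <= g k)%O by apply: gmono; exact: leq_pred.
  have [N' HN'] := coh_exhaust (fun y => cF' _ y (ga k)) gk1.
  exists (maxn N N') => n; rewrite geq_max => /andP[Nn N'n]; split.
    by have := HN _ Nn; rewrite addnS.
  exact: HN'.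
(* the index in use at stage [n]: it advances by one as soon as this is safe *)
pose kap := fix kap n := if n is n'.+1 then
   if kap n' is Some k then if (M k.+1 <= n)%N then Some k.+1 else Some k
   else if (M 0%N <= n)%N then Some 0%N else None else None.
have kapM n k : kap n = Some k -> (M k <= n)%N.
  elim: n k => [//|n IH] k /=; case: (kap n) IH => [j|] IH.
    by case: ifP => [h [<-//]|_ [<-]]; rewrite (leq_trans (IH _ erefl)).
  by case: ifP => // h [<-].
have kapS n k : kap n = Some k -> kap n.+1 = Some k \/
    (kap n.+1 = Some k.+1 /\ (M k.+1 <= n.+1)%N).
  by move=> /= ->; case: ifP => h; [right|left].
have kap_mono k n j : kap n = Some k -> exists2 k', kap (n + j)%N = Some k' & (k <= k')%N.
  move=> e; elim: j => [|j [k' e1 e2]]; first by exists k; rewrite ?addn0.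
  have [h|[h _]] := kapS _ _ e1; rewrite addnS; first by exists k'.
  by exists k'.+1; rewrite // ltnW.
have kap_oo k : exists N, forall n, (N <= n)%N ->
    exists2 k', kap n = Some k' & (k <= k')%N.
  elim: k => [|k [N HN]].
    exists (M 0%N).+1 => n; case: n => // n; rewrite ltnS => Mn /=.
    case e : (kap n) => [k'|]; first by case: ifP; eexists.
    by rewrite (leq_trans Mn)//; exists 0%N.
  pose m := maxn N (M k.+1).
  have [j ej kj] := HN m (leq_maxl _ _).
  have [k' e1 e2] : exists2 k', kap m.+1 = Some k' & (k < k')%N.
    move: kj; rewrite leq_eqVlt => /predU1P[kj|kj].
      by exists k.+1; rewrite //= ej -kj leqW// leq_maxr.
    have [h|[h _]] := kapS _ _ ej; first by exists j.
    by exists j.+1 => //; rewrite ltnW.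
  exists m.+1 => n /subnKC <-.
  have [k'' e3 e4] := kap_mono _ _ (n - m.+1)%N e1.
  by exists k'' => //; exact: leq_trans e4.
pose eta n := omap g (kap n).
exists (fun n => if eta n is Some b then rcons (F b n) a else [:: a]), eta.
split => //.
- by move=> n b; rewrite /eta; case: (kap n) => //= k [<-].
- move=> n b; rewrite /eta; case e : (kap n) => [k|//] [<-].
  have [h|[h Mk]] := kapS _ _ e; rewrite h /=.
    by exists (g k) => //; apply: coh_self; exact: cF.
  by exists (g k.+1) => //; exact: (HM _ _ Mk).2.
- move=> x /usurj[k <-]; have [N /(_ N (leqnn _))[k' e kk']] := kap_oo k.
  by exists N, (g k'); rewrite /eta e (le_trans (ug k))// gmono.
- move=> n; rewrite /eta; case e : (kap n) => [k|//] /=.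
  by have := (HM _ _ (kapM _ _ e)).1; rewrite size_rcons; lia.
- move=> k; have [N HN] := kap_oo k; exists N => n /HN[k' e kk'].
  rewrite /eta e /= size_rcons; have := (HM _ _ (kapM _ _ e)).1; lia.
Qed.

End Facts.

Lemma exists_coherent : exists F, forall a, coherent F a (F a).
Proof.
pose ext a (rec : forall b, (b < a)%O -> nat -> seq I) b :=
  if pselect (b < a)%O is left h then rec b h else fun=> [::].
pose step a (rec : forall b, (b < a)%O -> nat -> seq I) :=
  xget (fun=> [::]) [set phi | coherent (ext a rec) a phi].
pose F := Fix lt_wf _ step.
have FE a : F a = step a (fun b _ => F b).
  rewrite /F Fix_eq// => b f g fg; rewrite /step; congr (xget _ _).
  have -> // : f = g.
  by apply: functional_extensionality_dep => c; apply: functional_extensionality_dep.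
exists F; elim/(well_founded_ind lt_wf) => a IH.
have [phi cphi] := coherent_ext IH.
have eqF b : (b < a)%O -> ext a (fun b _ => F b) b = F b.
  by rewrite /ext; case: pselect.
rewrite FE /step; case: xgetP => [p _ /= cp|].
  by apply: eq_coherent cp => b /eqF.
by move=> /(_ phi) /=; case; apply: eq_coherent cphi => b /eqF.
Qed.

End CoherentFamily.

(** * The first uncountable ordinal *)

Lemma countable_inj (T U : Type) (A : set T) (B : set U) (f : T -> U) :
  (forall x, A x -> B (f x)) -> (forall x y, A x -> A y -> f x = f y -> x = y) ->
  countable B -> countable A.
Proof.
move=> AB finj /countable_injP[g ginj]; apply/countable_injP; exists (g \o f).
move=> x y; rewrite !inE => Ax Ay /= /ginj fxy; apply: finj => //.
by apply: fxy; rewrite inE; exact: AB.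
Qed.

Lemma countable_union (T : Type) (A B : set T) :
  countable A -> countable B -> countable (A `|` B).
Proof.
move=> cA cB; have -> : A `|` B = \bigcup_(b in [set: bool]) (if b then A else B).
  apply/seteqP; split => [x [Ax|Bx]|x [[] _]]; [by exists true|by exists false| |];
    by [left|right].
by apply: bigcup_countable => // -[].
Qed.

Section WellOrderedSubtype.
Variables (T : choiceType) (r : rel T) (P : pred T).
Hypothesis wo : wochoice.well_order r.

(** The well-order is an argument so that it can carry the order structure. *)
Definition wosub of wochoice.well_order r := {x : T | P x}.
Local Notation W := (wosub wo).
HB.instance Definition _ := Choice.on W.

Let chain x y : r x y || r y x.
Proof. by apply: (@wochoice.wo_chainW _ r predT) => // A _; exact: wo. Qed.
Let rxx x : r x x. Proof. by rewrite -[r x x]orbb chain. Qed.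
Let anti x y : r x y && r y x -> x = y.
Proof.
by apply: (@wochoice.wo_chain_antisymmetric _ r predT) => // A _; exact: wo.
Qed.
Let trans : transitive r.
Proof.
move=> y x z xy yz; have [|m [[Am lbm] _]] := wo (A := [pred u | u \in [:: x; y; z]]).
  by exists x; rewrite !inE eqxx.
have lx := lbm x; have ly := lbm y; have lz := lbm z.
move: Am lx ly lz; rewrite !inE !eqxx !orbT => /or3P[]/eqP-> lx ly lz.
- exact: lz.
- by rewrite (anti (x := x) (y := y)) ?yz// xy lx.
- have zy : y = z by apply: anti; rewrite yz ly.
  by rewrite -zy.
Qed.

Let le (x y : W) := r (val x) (val y).
Let lexx : reflexive le. Proof. by move=> x; exact: rxx. Qed.
Let le_anti : antisymmetric le.
Proof. by move=> x y /anti /val_inj. Qed.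
Let le_trans : transitive le. Proof. by move=> y x z; exact: trans. Qed.
HB.instance Definition _ :=
  Order.Le_isPOrder.Build (Order.Disp tt tt) W lexx le_anti le_trans.
HB.instance Definition _ :=
  Order.POrder_isTotal.Build (Order.Disp tt tt) W (fun x y => chain _ _).

Lemma wosub_leE (x y : W) : (x <= y)%O = r (val x) (val y). Proof. by []. Qed.

Lemma wosub_ltE (x y : W) : (x < y)%O = (val y != val x) && r (val x) (val y).
Proof. by rewrite lt_neqAle eq_sym. Qed.

Lemma wosub_well_order : wochoice.well_order (<=%O : rel W).
Proof.
apply: wochoice.antisymmetric_well_order => [|A [x Ax]]; first exact: le_anti.
pose B := [pred u : T | `[< exists2 y : W, y \in A & val y = u >]].
have [|m [[/asboolP[y Ay ym] lbm] _]] := wo (A := B).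
  by exists (val x); apply/asboolP; exists x.
exists y; split => // z Az; rewrite wosub_leE ym; apply: lbm.
by apply/asboolP; exists z.
Qed.
End WellOrderedSubtype.

Lemma set_nat_uncountable : ~ countable [set: set nat].
Proof.
move=> /countable_injP[f finj].
pose D : set nat := [set n | exists2 A : set nat, f A = n & ~ A n].
have fI A B : f A = f B -> A = B by move=> AB; apply: finj; rewrite ?inE.
have [DfD|nD] := pselect (D (f D)); last by apply: (nD); exists D.
by case: (DfD) => A /fI-> .
Qed.

(** The points with countably many predecessors form an initial segment; were
    it countable, the least point outside it would belong to it. *)
Lemma exists_omega1 : exists (d : Order.disp_t) (I : orderType d), is_omega1 I.
Proof.
have [r wo] := wochoice.well_ordering_principle (set nat : choiceType).
pose below x := [set y : set nat | r y x && (x != y)].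
pose P : pred (set nat) := fun x => `[< countable (below x) >].
exists (Order.Disp tt tt), (wosub P wo); split; first exact: wosub_well_order.
- move=> cW.
  have cP : countable [set x | P x].
    have -> : [set x | P x] = val @` [set: wosub P wo].
      apply/seteqP; split => [x Px|_ [[x Px] _ <-]//].
      by exists (exist _ x Px).
    by apply: (sub_countable _ cW); exact: card_image_le.
  have [all|/existsNP[x0 nPx0]] := pselect (forall x, P x).
    by apply: set_nat_uncountable; apply: sub_countable cP; apply: subset_card_le => x _; exact: all.
  have [|m [[/= nPm lbm] _]] := wo [pred x | ~~ P x].
    by exists x0; apply/negP.
  move/negP: nPm; apply; apply/asboolP; apply: sub_countable cP.
  apply: subset_card_le => y /= /andP[ym my]; apply: contraT => nPy.
  have := lbm y nPy => my'; case/eqP: my.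
  by apply: (@wochoice.wo_chain_antisymmetric _ r predT) => //; [move=> A _; exact: wo|rewrite my'].
- move=> a; have /asboolP ca := valP a.
  apply: (@countable_inj _ _ _ _ val _ _ ca) => [b|x y _ _]; last exact: val_inj.
  by rewrite /= wosub_ltE => /andP[ab ba]; apply/andP.
Qed.

Lemma omega1_wf (d : Order.disp_t) (I : orderType d) : is_omega1 I ->
  well_founded (fun a b : I => (a < b)%O).
Proof.
move=> [wo _ _] a; apply: contrapT => nacc.
have [|m [[nm lbm] _]] := wo [pred b | `[< ~ Acc (fun a b : I => (a < b)%O) b >]].
  by exists a; apply/asboolP.
move/asboolP : nm; apply; constructor => b bm; apply: contrapT => nb.
have := lbm b (asboolT nb); by rewrite leNgt bm.
Qed.

Lemma omega1_min (d : Order.disp_t) (I : orderType d) (A : set I) : is_omega1 I ->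
  A !=set0 -> exists2 m, A m & forall x, A x -> (m <= x)%O.
Proof.
move=> [wo _ _] [a Aa]; have [|m [[Am lbm] _]] := wo [pred x | `[< A x >]].
  by exists a; apply/asboolP.
by exists m; [exact/asboolP|move=> x Ax; apply: lbm; apply/asboolP].
Qed.

(** An unbounded countable set and the countable segments below its elements would
    cover everything. *)
Lemma omega1_bound (d : Order.disp_t) (I : orderType d) (A : set I) : is_omega1 I ->
  countable A -> exists b, forall a, A a -> (a < b)%O.
Proof.
move=> [_ nc below] cA; apply: contrapT => nb; apply: nc.
apply: (@sub_countable _ _ _ (\bigcup_(a in A) [set b | (b < a)%O] `|` A)).
  apply: subset_card_le => b _; apply: contrapT => nAb; apply: nb; exists b => a Aa.
  rewrite ltNge le_eqVlt; apply/negP => /predU1P[ba|ba]; apply: nAb.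
    by right; rewrite ba.
  by left; exists a.
by apply: countable_union => //; apply: bigcup_countable.
Qed.

(** * The compact family of subsets *)

Lemma seq_max (d : Order.disp_t) (I : orderType d) (s : seq I) : s != [::] ->
  exists2 c, c \in s & forall x, x \in s -> (x <= c)%O.
Proof.
elim: s => // x s IH _; have [->|/IH[c cs cmax]] := eqVneq s [::].
  by exists x; [exact: mem_head|move=> y; rewrite inE => /eqP->].
have [xc|/ltW cx] := leP x c.
  exists c; first by rewrite inE cs orbT.
  by move=> y; rewrite inE => /predU1P[->//|/cmax].
exists x; first exact: mem_head.
by move=> y; rewrite inE => /predU1P[->//|/cmax yc]; exact: le_trans cx.
Qed.

(** With [rho x b] the least [n] such that [x] belongs to the [n]-th set of [b], this
    is a subadditive function on pairs of countable ordinals, in the sense of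
    Todorcevic, whose balls [{x <= b | rho x b <= n}] have at most [n + 1] elements. *)
Record coherent_family (d : Order.disp_t) (I : orderType d) := CoherentFamily {
  cfam :> I -> nat -> seq I;
  cfam_le : forall b n x, x \in cfam b n -> (x <= b)%O;
  cfam_self : forall b n, b \in cfam b n;
  cfam_filter : forall b n x, x \in cfam b n ->
    cfam x n = [seq y <- cfam b n | (y <= x)%O];
  cfam_exhaust : forall b x, (x <= b)%O ->
    exists N, forall n, (N <= n)%N -> x \in cfam b n;
  cfam_size : forall b n, (size (cfam b n) <= n.+1)%N }.

Lemma exists_coherent_family (d : Order.disp_t) (I : orderType d) :
  is_omega1 I -> inhabited (coherent_family I).
Proof.
move=> om; have [_ _ below] := om.
have [F cF] := exists_coherent (omega1_wf om) below.
split; exists F => [b n x|b n|b n x|b x|b n].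
- by apply: (coh_le (omega1_wf om)).
- exact: coh_self.
- by apply: (coh_filter (omega1_wf om)).
- by apply: (coh_exhaust (omega1_wf om)).
- by have [eta e] := cF b; exact: coh_size e n.
Qed.

(** Codes for the members of the compact family; a set may have several codes. *)
Inductive point (I : Type) := Fin of I & nat | Seg of I | Top.
Arguments Top {I}.

Section Points.
Variables (d : Order.disp_t) (I : orderType d) (om : is_omega1 I).
Variable F : coherent_family I.
Implicit Types (t : point I) (a b x : I).

Definition pset t : set I := match t with
  | Fin b n => [set` F b n]
  | Seg a => [set x | (x < a)%O]
  | Top => setT
  end.

Lemma cfam0 b : F b 0%N = [:: b].
Proof.
have := cfam_size F b 0; have := cfam_self F b 0.
by case: (F b 0%N) => [|c [|? ?]]//; rewrite inE => /eqP->.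
Qed.

Lemma pset_single b : pset (Fin b 0) = [set b].
Proof. by rewrite /= cfam0; apply/seteqP; split => x /=; rewrite inE => /eqP. Qed.

Definition points_below a : set (point I) :=
  [set t | match t with Fin b _ => (b <= a)%O | Seg b => (b <= a)%O | Top => False end].

(** The family is stable under intersection with initial segments: this is where
    coherence enters. *)
Lemma pset_cut t a : exists2 t', points_below a t' &
  pset t' = pset t `&` [set x | (x < a)%O].
Proof.
case: t => [b n|b|]; last 2 first.
- by exists (Seg (Order.min b a)); [rewrite /= ge_min lexx orbT|
    apply/seteqP; split => x /=; rewrite lt_min => /andP].
- by exists (Seg a) => //=; rewrite setTI.
pose s := [seq x <- F b n | (x < a)%O].
have sE x : (x \in s) <-> (pset (Fin b n) `&` [set x | (x < a)%O]) x.
  by rewrite mem_filter; split => [/andP[]|[/= -> ->]].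
have [s0|/seq_max[c cs cmax]] := eqVneq s [::].
  have [m _ mmin] := omega1_min (A := [set: I]) om (ex_intro _ a Logic.I).
  exists (Seg m); first exact: mmin.
  apply/seteqP; split => x; first by rewrite /= ltNge mmin.
  by move=> /sE; rewrite s0.
have [cF ca] := (sE c).1 cs.
exists (Fin c n); first exact: ltW.
apply/seteqP; split => x /=; rewrite (cfam_filter cF) mem_filter.
  by move=> /andP[xc ->]; split => //; exact: le_lt_trans ca.
by move=> xs; rewrite cmax ?xs.1//; apply/sE.
Qed.

Lemma countable_points_below a : countable (points_below a).
Proof.
have cle : countable [set b | (b <= a)%O].
  have -> : [set b | (b <= a)%O] = [set b | (b < a)%O] `|` [set a].
    apply/seteqP; split => b /=; rewrite le_eqVlt.
      by move=> /predU1P[->|]; [right|left].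
    by move=> [->|->]; rewrite ?eqxx ?orbT.
  by apply: countable_union; [have [_ _] := om; exact|exact: countable1].
have -> : points_below a =
    [set Fin p.1 p.2 | p in [set b | (b <= a)%O] `*` [set: nat]] `|`
    [set Seg b | b in [set b | (b <= a)%O]].
  apply/seteqP; split => [[b n|b|]//= ba|_ [[[b n] [/= ba _] <-]//|[b ba <-]//]].
    by left; exists (b, n).
  by right; exists b.
by apply: countable_union; apply: sub_countable (card_image_le _ _) _ => //;
  exact: countableX.
Qed.

(** The family is closed in the product topology: a limit of the sets [F b n]
    that is not an initial segment involves only boundedly many [n], hence has
    boundedly many elements. *)
Lemma pset_closed (A : set I) :
  (forall s : seq I, exists t, forall x, x \in s -> (A x <-> pset t x)) ->
  exists t, pset t = A.
Proof.
move=> limA.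
have [init|] := pselect (forall b x, A b -> (x < b)%O -> A x).
  have [all|/existsNP[x0 nAx0]] := pselect (forall x, A x).
    by exists Top; apply/seteqP; split.
  have [m nAm mmin] := omega1_min (A := ~` A) om (ex_intro _ x0 nAx0).
  exists (Seg m); apply/seteqP; split => x /= => [xm|Ax].
    by apply: contrapT => /mmin; rewrite leNgt xm.
  rewrite ltNge le_eqVlt; apply/negP => /predU1P[mx|mx].
    by apply: nAm; rewrite mx.
  by apply: nAm; exact: init Ax mx.
move=> /existsNP[b /existsNP[xi /not_implyP[Ab /not_implyP[xib nAxi]]]].
have [N HN] := cfam_exhaust F (ltW xib).
(* [xi] is missed below [b], so sets close to [A] are [F c n] with [n < N] *)
have fin (s : seq I) : exists c n, (n < N)%N /\ forall x, x \in s -> (A x <-> x \in F c n).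
  have [t Ht] := limA [:: b, xi & s].
  have tb : pset t b by apply: (Ht b _).1 => //; rewrite mem_head.
  have txi : ~ pset t xi.
    by move=> h; apply: nAxi; apply: (Ht xi _).2 => //; rewrite !inE eqxx orbT.
  case: t Ht tb txi => [c n|c|] Ht tb txi; last 2 first.
  - by case: txi => /=; exact: lt_trans tb.
  - by case: txi.
  exists c, n; split; last by move=> x xs; apply: Ht; rewrite !inE xs !orbT.
  rewrite ltnNge; apply/negP => Nn; apply: txi.
  by have := HN _ Nn; rewrite (cfam_filter tb) mem_filter => /andP[].
have [s sA As] : exists2 s : seq I, (forall x, x \in s -> A x) & forall x, A x -> x \in s.
  apply: contrapT => nos.
  have grow k : exists s : seq I, [/\ uniq s, size s = k & forall x, x \in s -> A x].
    elim: k => [|k [s [us ss sA]]]; first by exists [::].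
    have [x [Ax xs]] : exists x, A x /\ x \notin s.
      apply: contrapT => nx; apply: nos; exists s => // x Ax.
      by apply: contrapT => /negP xs; apply: nx; exists x.
    exists (x :: s); rewrite /= xs us ss; split => // y.
    by rewrite inE => /predU1P[->//|/sA].
  have [s [us ss sA]] := grow N.+1.
  have [c [n [nN sF]]] := fin s.
  have /(uniq_leq_size us) : {subset s <= F c n} by move=> x xs; apply/sF/sA.
  by rewrite ss => /leq_trans/(_ (cfam_size _ _ _)); rewrite ltnS leqNgt nN.
have [|c cs cmax] := @seq_max _ _ s; first by case: s As {sA} => // /(_ b Ab).
have [b' [n [nN sF]]] := fin (s ++ flatten [seq F c n | n <- iota 0 N]).
have cF : c \in F b' n by apply/sF; [rewrite mem_cat cs|exact: sA].
exists (Fin c n); apply/seteqP; split => x /= => [xF|Ax].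
  apply/sF; last by move: xF; rewrite (cfam_filter cF) mem_filter => /andP[].
  rewrite mem_cat; apply/orP; right; apply/flatten_mapP; exists n => //.
  by rewrite mem_iota.
rewrite (cfam_filter cF) mem_filter cmax ?As//=; apply/sF => //.
by rewrite mem_cat As.
Qed.

(** An initial segment agrees on a finite set [s] with [F c n] for [n] large, where
    [c] is the last element of [s] in the segment; if there is none, only the empty
    set is left. *)
Lemma pset_finite_dense t (s : seq I) :
  (exists b n, forall x, x \in s -> (pset t x <-> x \in F b n)) \/
  (forall x, x \in s -> ~ pset t x).
Proof.
have seg A : (forall b x, A b -> (x <= b)%O -> A x) ->
    (exists b n, forall x, x \in s -> (A x <-> x \in F b n)) \/
    (forall x, x \in s -> ~ A x).
  move=> init; pose s' := [seq x <- s | `[< A x >]].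
  have [s0|/seq_max[c]] := eqVneq s' [::].
    right => x xs Ax; have : x \in s' by rewrite mem_filter xs andbT; apply/asboolP.
    by rewrite s0.
  rewrite mem_filter => /andP[/asboolP Ac cs] cmax; left.
  have [N HN] : exists N, forall n, (N <= n)%N ->
      forall x, x \in s -> (x <= c)%O -> x \in F c n.
    elim: s {s' cs cmax} => [|y s [N IH]]; first by exists 0%N.
    have [yc|cy] := leP y c; last first.
      exists N => n Nn x; rewrite inE => /predU1P[->|/(IH _ Nn)//].
      by rewrite leNgt cy.
    have [M HM] := cfam_exhaust F yc; exists (maxn M N) => n.
    rewrite geq_max => /andP[Mn Nn] x.
    by rewrite inE => /predU1P[-> _|/(IH _ Nn)//]; exact: HM.
  exists c, N => x xs; split => [Ax|/cfam_le xc]; last exact: init Ac xc.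
  by apply: (HN N) => //; apply: cmax; rewrite mem_filter xs andbT; apply/asboolP.
case: t => [b n|a|]; first by left; exists b, n.
- by apply: seg => b x /= ba xb; exact: le_lt_trans ba.
- exact: seg.
Qed.
End Points.

(** * The space spanned by the coordinate functions of a set system *)

Lemma span_seq (K : numFieldType) (V : lmodType K) (A : set V) (J : Type)
    (s : seq (K * J)) (w : J -> V) :
  (forall j, A (w j)) -> Defs.span A (\sum_(p <- s) p.1 *: w p.2).
Proof.
move=> Aw; case: s => [|p0 s].
  by exists 0%N, (fun=> 0), (fun=> 0); split => [[]//|]; rewrite big_nil big_ord0.
exists (size (p0 :: s)), (fun i => (nth p0 (p0 :: s) i).1),
  (fun i => w (nth p0 (p0 :: s) i).2); split => //.
by rewrite (big_nth p0) big_mkord.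
Qed.

Lemma span_ind (K : numFieldType) (V : lmodType K) (A : set V) (P : V -> Prop) :
  P 0 -> (forall c u v, A u -> P v -> P (c *: u + v)) ->
  forall v, Defs.span A v -> P v.
Proof.
move=> P0 PD v [n [c [w [Aw ->]]]].
by elim/big_rec : _ => // i u _ Pu; exact: PD.
Qed.

Section SetSystemSpace.
Variables (R : realType) (K : numFieldType) (S : scalars R K).
Variables (T : Type) (I : eqType) (mem : T -> set I).
Local Notation N := (modulus S).

Definition coord (i : I) (t : T) : K := (`[< mem t i >])%:R.

Definition comb (s : seq (K * I)) (t : T) : K := \sum_(p <- s) p.1 * coord p.2 t.

Lemma coord_le1 i t : N (coord i t) <= 1.
Proof. by rewrite /coord; case: asboolP => _; rewrite ?modulus1 ?modulus0. Qed.

Definition near_comb (x : T -> K) : Prop :=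
  forall e, 0 < e -> exists s, forall t, N (x t - comb s t) <= e.

Lemma near_comb0 : near_comb (fun=> 0).
Proof.
by move=> e e0; exists [::] => t; rewrite /comb big_nil subr0 modulus0 ltW.
Qed.

Lemma near_combZD a x y : near_comb x -> near_comb y ->
  near_comb (fun t => a * x t + y t).
Proof.
move=> nx ny e e0; have Na := modulus_ge0 S a.
have e2 : 0 < e / 2 by rewrite divr_gt0.
have [s Hs] := nx (e / 2 / (N a + 1)) (divr_gt0 e2 (ltr_wpDl Na ltr01)).
have [r Hr] := ny _ e2.
exists ([seq (a * p.1, p.2) | p <- s] ++ r) => t.
rewrite /comb big_cat big_map/=.
under eq_bigr do rewrite -mulrA.
rewrite -mulr_sumr opprD addrACA -mulrBr (le_trans (modulusD _ _ _))//.
rewrite modulusM [leRHS]splitr lerD//.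
rewrite (le_trans (ler_wpM2l Na (Hs t)))// mulrCA ler_piMr//; first lra.
by rewrite ler_pdivrMr ?mul1r; lra.
Qed.

Lemma near_comb_bounded x : near_comb x -> exists M, forall t, N (x t) <= M.
Proof.
move=> /(_ 1 ltr01)[s Hs]; exists (1 + \sum_(p <- s) N p.1) => t.
rewrite -[x t](subrK (comb s t)) (le_trans (modulusD _ _ _))// lerD//.
rewrite (le_trans (modulus_sum _ _ _ _))//; apply: ler_sum => p _.
by rewrite modulusM ler_piMr ?modulus_ge0 ?coord_le1.
Qed.

Lemma near_comb_closed x : (forall e, 0 < e ->
    exists2 y, near_comb y & forall t, N (x t - y t) <= e) -> near_comb x.
Proof.
move=> h e e0; have e2 : 0 < e / 2 by rewrite divr_gt0.
have [y ny xy] := h _ e2; have [s Hs] := ny _ e2; exists s => t.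
rewrite -[x t](subrK (y t)) -addrA (le_trans (modulusD _ _ _))//.
by rewrite [leRHS]splitr lerD.
Qed.

Definition system_uspace : uspace S T :=
  USpace near_comb0 near_combZD near_comb_bounded near_comb_closed.

Definition system_space := uelt system_uspace.
HB.instance Definition _ := CompleteNormedModule.on system_space.
Local Notation X := system_space.
Implicit Types x y : X.

Lemma coord_near i : coord i \in uspred system_uspace.
Proof.
apply/asboolP => e e0; exists [:: (1, i)] => t.
by rewrite /comb big_seq1 mul1r subrr modulus0 ltW.
Qed.

Definition coordX i : X := UElt (coord_near i).

Definition combX (s : seq (K * I)) : X := \sum_(p <- s) p.1 *: coordX p.2.

Lemma combXE s t : combX s t = comb s t.
Proof. by rewrite /combX ufun_sum. Qed.

Lemma combX_dense x e : 0 < e -> exists s, supn (x - combX s) <= e.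
Proof.
move=> e0; have [s Hs] := (ueltP x : near_comb x) _ e0; exists s.
by apply: supn_le => [|t]; [exact: ltW|rewrite ufunB combXE].
Qed.

Lemma system_approx (x : X) t s : N (x t - comb s t) <= supn (x - combX s).
Proof. by rewrite -combXE -ufunB supn_ge. Qed.

(** Elements are continuous on the set system: a combination of coordinates depends
    only on the memberships that occur in it. *)
Lemma system_local x e : 0 < e -> exists s : seq I, forall t u,
  (forall i, i \in s -> (mem t i <-> mem u i)) -> N (x t - x u) <= e.
Proof.
move=> e0; have [s Hs] := combX_dense x (divr_gt0 e0 (ltr0Sn _ 1)).
exists (map snd s) => t u tu.
have -> : x t - x u = (x t - comb s t) - (x u - comb s u).
  have -> : comb s t = comb s u.
    rewrite /comb big_seq [RHS]big_seq; apply: eq_bigr => p ps.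
    congr (_ * _); rewrite /coord; congr (_%:R); congr (nat_of_bool _).
    by apply: asbool_equiv_eq; apply: tu; exact: map_f.
  by rewrite opprB addrA subrK.
rewrite (le_trans (modulusD _ _ _))// modulusN.
by rewrite [leRHS]splitr lerD// (le_trans (system_approx _ _ _) Hs).
Qed.

(** Linear relations between evaluations need only be tested on coordinates, whose
    combinations are dense. *)
Lemma system_eval_eq0 (J : Type) (r : seq J) (a : J -> K) (t : J -> T) x :
  (forall i, \sum_(j <- r) a j * coord i (t j) = 0) ->
  \sum_(j <- r) a j * x (t j) = 0.
Proof.
move=> h; have hc s : \sum_(j <- r) a j * comb s (t j) = 0.
  under eq_bigr => j _ do rewrite /comb mulr_sumr.
  rewrite exchange_big big1// => p _.
  under eq_bigr => j _ do rewrite mulrCA.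
  by rewrite -mulr_sumr h mulr0.
apply: (@modulus_eq0 _ _ S); apply: le_anti; rewrite modulus_ge0 andbT.
pose M := \sum_(j <- r) N (a j).
have M0 : 0 <= M by apply: sumr_ge0 => j _; exact: modulus_ge0.
apply/ler_addgt0Pr => e e0; rewrite add0r.
have [s Hs] := combX_dense x (divr_gt0 e0 (ltr_wpDl M0 ltr01)).
have -> : \sum_(j <- r) a j * x (t j) =
    \sum_(j <- r) a j * (x (t j) - comb s (t j)).
  by under [RHS]eq_bigr => j _ do rewrite mulrBr; rewrite sumrB hc subr0.
rewrite (le_trans (modulus_sum _ _ _ _))//.
under eq_bigr => j _ do rewrite modulusM.
rewrite (@le_trans _ _ (\sum_(j <- r) N (a j) * (e / (M + 1))))//.
  apply: ler_sum => j _; rewrite ler_wpM2l ?modulus_ge0//.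
  exact: le_trans (system_approx _ _ _) Hs.
rewrite -mulr_suml -/M mulrCA ler_piMr//; first lra.
by rewrite ler_pdivrMr ?mul1r; lra.
Qed.

End SetSystemSpace.

(** * Spans, suprema and functionals *)

Section Span.
Variables (K : numFieldType) (V : lmodType K) (A : set V).

Lemma span_seqP v : Defs.span A v <->
  exists s : seq (K * {u | A u}), v = \sum_(p <- s) p.1 *: sval p.2.
Proof.
split => [[n [c [w [Aw ->]]]]|[s ->]]; last first.
  exact: (@span_seq _ _ _ _ s (fun u : {u | A u} => sval u) (fun u => svalP u)).
exists [seq (c i, exist _ (w i) (Aw i)) | i <- index_enum 'I_n].
by rewrite big_map.
Qed.

Lemma spanZD a u v : Defs.span A u -> Defs.span A v -> Defs.span A (a *: u + v).
Proof.
move=> /span_seqP[s ->] /span_seqP[r ->]; apply/span_seqP.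
exists ([seq (a * p.1, p.2) | p <- s] ++ r); rewrite big_cat big_map/=.
by rewrite scaler_sumr; congr (_ + _); apply: eq_bigr => p _; rewrite scalerA.
Qed.

Lemma span_gen u : A u -> Defs.span A u.
Proof.
by move=> Au; apply/span_seqP; exists [:: (1, exist _ u Au)]; rewrite big_seq1 scale1r.
Qed.

Lemma span_0 : Defs.span A 0.
Proof. by apply/span_seqP; exists [::]; rewrite big_nil. Qed.

Lemma spanZ a u : Defs.span A u -> Defs.span A (a *: u).
Proof. by move=> Au; rewrite -[_ *: _]addr0; apply: spanZD => //; exact: span_0. Qed.

Lemma span_sum (J : Type) (s : seq J) (F : J -> V) :
  (forall j, Defs.span A (F j)) -> Defs.span A (\sum_(j <- s) F j).
Proof.
move=> AF; elim/big_ind : _ => //; first exact: span_0.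
by move=> u v Au Av; rewrite -[u]scale1r; exact: spanZD.
Qed.
End Span.

Section LinearFacts.
Variables (K : numFieldType) (V W : lmodType K) (f : V -> W).
Hypothesis lf : linear f.
Let L : {linear V -> W} := HB.pack f (GRing.isLinear.Build _ _ _ _ f lf).

Lemma lin0 : f 0 = 0. Proof. exact: (raddf0 L). Qed.
Lemma linB u v : f (u - v) = f u - f v. Proof. exact: (raddfB L). Qed.
Lemma linZ a u : f (a *: u) = a *: f u. Proof. exact: (linearZ_LR L). Qed.
Lemma lin_sum (J : Type) (s : seq J) (P : pred J) (F : J -> V) :
  f (\sum_(j <- s | P j) F j) = \sum_(j <- s | P j) f (F j).
Proof. exact: (raddf_sum L). Qed.
End LinearFacts.

Section EmbSupremum.
Variables (R : realType) (K : numFieldType) (S : scalars R K).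

(** The order of the complex numbers is partial, but an upper bound of nonnegative
    reals is real. *)
Lemma supremum_emb (A : set R) : (forall r, A r -> 0 <= r) -> has_sup A ->
  supremum 0 (emb S @` A) = emb S (sup A).
Proof.
move=> A0 hA; have [a0 Aa0] := hA.1; rewrite /supremum ifF; last first.
  by apply/negP => /eqP; apply/eqP/set0P; exists (emb S a0), a0.
have hsup : supremums (emb S @` A) (emb S (sup A)).
  split => [_ [r Ar <-]|u ubu].
    by rewrite emb_le; apply: sup_ubound => //; exact: hA.2.
  have u0 : 0 <= u.
    by rewrite (le_trans _ (ubu _ (ex_intro2 _ _ a0 Aa0 erefl)))// emb_ge0 A0.
  rewrite -(emb_re S u0) emb_le; apply: ge_sup => [|r Ar]; first by exists a0.
  by rewrite -(emb_le S) emb_re// ubu//; exists r.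
by case: xgetP => [y _ hy|/(_ _ hsup)//]; exact: is_subset1_supremums hy hsup.
Qed.

Lemma supremum_norm (Y : Type) (D : set Y) (h : Y -> K) M : D !=set0 ->
  (forall y, D y -> modulus S (h y) <= M) ->
  supremum 0 [set `|h y| | y in D] = emb S (sup [set modulus S (h y) | y in D]).
Proof.
move=> [y0 Dy0] hM; rewrite -supremum_emb.
- congr (supremum 0 _); apply/seteqP; split => [_ [y Dy <-]|_ [_ [y Dy <-] <-]].
    by exists (modulus S (h y)); [exists y|rewrite emb_modulus].
  by exists y; rewrite ?emb_modulus.
- by move=> _ [y _ <-]; exact: modulus_ge0.
- split; first by exists (modulus S (h y0)), y0.
  by exists M => _ [y Dy <-]; exact: hM.
Qed.
End EmbSupremum.

Section UniformSpaceFunctionals.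
Variables (R : realType) (K : numFieldType) (S : scalars R K) (T : Type).
Variable E : uspace S T.
Local Notation X := (uelt E).
Local Notation N := (modulus S).
Implicit Types (x y : X) (phi : X -> K^o).

Lemma uelt_ballP x y e : 0 < e -> supn (x - y) < re S e <-> ball x e y.
Proof.
by move=> e0; rewrite -ball_normE /ball_/= unormE -{2}(emb_re S (ltW e0)) emb_lt.
Qed.

Lemma re_gt0 e : 0 < e -> 0 < re S e.
Proof. by move=> e0; rewrite -(emb_gt0 S) emb_re// ltW. Qed.

Lemma uelt_closureP (A : set X) y : closure A y ->
  forall e, 0 < e -> exists2 v, A v & supn (y - v) <= e.
Proof.
move=> cA e e0; have [|v [Av]] := cA (ball y (emb S e)).
  by apply: nbhsx_ballx; rewrite emb_gt0.
rewrite -uelt_ballP ?emb_gt0// re_emb => yv.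
by exists v => //; exact: ltW.
Qed.

Lemma uelt_denseP (A : set X) :
  (forall x e, 0 < e -> exists2 v, A v & supn (x - v) <= e) -> dense A.
Proof.
move=> h O [x Ox] oO; have /nbhs_ballP[e /= e0 xeO] := open_nbhs_nbhs (conj oO Ox).
have re0 := re_gt0 e0.
have [v Av xv] := h x (re S e / 2) (divr_gt0 re0 (ltr0Sn _ 1)).
exists v; split => //; apply: xeO; apply/uelt_ballP => //; lra.
Qed.

Definition bounded_by (C : R) phi := forall x, N (phi x) <= C * supn x.

Lemma additive_bounded_continuous phi C :
  (forall x y, phi (x - y) = phi x - phi y) -> bounded_by C phi -> continuous phi.
Proof.
move=> phiB bphi x A /nbhs_ballP[e /= e0 eA].
have re0 := re_gt0 e0; have C'0 : 0 < `|C| + 1 by rewrite ltr_wpDl.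
apply/nbhs_ballP; exists (emb S (re S e / (`|C| + 1))).
  by rewrite /= emb_gt0 divr_gt0.
move=> y /uelt_ballP; rewrite emb_gt0 divr_gt0// re_emb ltr_pdivlMr// => /(_ isT) xy.
apply: eA; rewrite /ball/= /ball/= -phiB -(emb_modulus S) -(emb_re S (ltW e0)) emb_lt.
apply: le_lt_trans (bphi _) _; apply: le_lt_trans xy.
by rewrite mulrC ler_wpM2l ?supn_ge0//; have := ler_norm C; lra.
Qed.

Lemma bounded_dual phi C : linear phi -> bounded_by C phi -> Defs.dual phi.
Proof.
by move=> lphi bphi; split=> //; apply: additive_bounded_continuous bphi; exact: linB.
Qed.

Lemma dual_normE phi C : bounded_by C phi ->
  dual_norm phi = emb S (sup [set N (phi x) | x in [set x | supn x <= 1]]).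
Proof.
move=> bphi.
have -> : [set x | supn x <= 1] = [set x : X | `|x| <= 1].
  by apply/seteqP; split => x /=; rewrite unormE -(rmorph1 (emb S)) emb_le.
apply: (@supremum_norm _ _ _ _ _ _ `|C|).
  by exists 0; rewrite /= normr0.
move=> x /=; rewrite unormE -(rmorph1 (emb S)) emb_le => x1.
rewrite (le_trans (bphi x))// (le_trans (ler_norm _))// normrM.
by rewrite ler_piMr// ger0_norm// supn_ge0.
Qed.

Lemma dual_norm_has_sup phi C : bounded_by C phi ->
  has_sup [set N (phi x) | x in [set x | supn x <= 1]].
Proof.
move=> bphi; split.
  exists (N (phi 0)), 0 => //=; apply: supn_le => // t.
  by rewrite ufun0 modulus0.
exists `|C| => _ [x /= x1 <-].
rewrite (le_trans (bphi x))// (le_trans (ler_norm _))// normrM.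
by rewrite ler_piMr// ger0_norm// supn_ge0.
Qed.

Lemma dual_norm_le1 phi C : linear phi -> bounded_by C phi ->
  (dual_norm phi <= 1) <-> bounded_by 1 phi.
Proof.
move=> lphi bphi; rewrite (dual_normE bphi) -(rmorph1 (emb S)) emb_le.
have [ne ub] := dual_norm_has_sup bphi.
split => [h x|h]; last first.
  apply: ge_sup => // _ [x /= x1 <-].
  by rewrite (le_trans (h x))// mul1r.
rewrite mul1r; have [x0|x0] := eqVneq (supn x) 0.
  by rewrite (le_trans (bphi x))// x0 mulr0.
have xp : 0 < supn x by rewrite lt_neqAle eq_sym x0 supn_ge0.
have : N (phi (emb S (supn x)^-1 *: x)) <= 1.
  apply: le_trans h; apply: sup_ubound => //; exists (emb S (supn x)^-1 *: x) => //=.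
  by rewrite supnZ modulus_emb ger0_norm ?invr_ge0 ?supn_ge0// mulVf.
rewrite (linZ lphi) modulusM modulus_emb.
by rewrite ger0_norm ?invr_ge0 ?supn_ge0// ler_pdivrMl// mulr1.
Qed.

Lemma dual_norm_eq1 phi x : linear phi -> bounded_by 1 phi ->
  supn x <= 1 -> N (phi x) = 1 -> dual_norm phi = 1.
Proof.
move=> lphi bphi x1 phix; apply: le_anti; rewrite (dual_norm_le1 lphi bphi).2//=.
rewrite (dual_normE bphi) -(rmorph1 (emb S)) emb_le -[leLHS]phix.
by apply: sup_ubound; [exact: (dual_norm_has_sup bphi).2|exists x].
Qed.

Definition eval_at (t : T) : X -> K^o := fun x => x t.

Lemma eval_at_linear t : linear (eval_at t). Proof. by []. Qed.

Lemma eval_at_bounded t : bounded_by 1 (eval_at t).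
Proof. by move=> x; rewrite mul1r; exact: supn_ge. Qed.

Lemma eval_at_dual t : Defs.dual (eval_at t).
Proof. exact: bounded_dual (eval_at_linear t) (eval_at_bounded t). Qed.

(** Pointwise approximation is exact on finite sets: if [M] separates points, every
    finite set is fixed by a finite rank operator whose functionals lie in the
    span of [M], and composing with it moves any functional into that span. *)
Lemma separating_weak_star_dense (M : set (X -> K^o)) :
  (forall phi, M phi -> linear phi) ->
  (forall x, (forall phi, M phi -> phi x = 0) -> x = 0) ->
  weak_star_dense (Defs.span M).
Proof.
move=> Mlin Msep.
have rank (l : seq X) : exists s : seq ((X -> K^o) * X),
    (forall p, p \in s -> Defs.span M p.1) /\
    forall x, x \in l -> \sum_(p <- s) (p.1 x : K) *: p.2 = x.
  elim: l => [|x l [s [sM sl]]]; first by exists [::].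
  pose r := x - \sum_(p <- s) (p.1 x : K) *: p.2.
  have [r0|rn0] := eqVneq r 0.
    exists s; split => // y; rewrite inE => /predU1P[->|/sl//].
    by apply/esym/eqP; rewrite -subr_eq0; apply/eqP.
  have [m Mm mr] : exists2 m, M m & m r != 0.
    apply: contrapT => no; move/eqP: rn0; apply; apply: Msep => m Mm.
    by apply: contrapT => /eqP mr; apply: no; exists m.
  have lm := Mlin _ Mm.
  (* equal to 1 at [x], and vanishing on the vectors that are already fixed *)
  pose n : X -> K^o := (m r)^-1 *: (m - \sum_(p <- s) (m p.2 : K) *: p.1).
  have nE v : n v = (m r)^-1 * m (v - \sum_(p <- s) (p.1 v : K) *: p.2).
    have e : (\sum_(p <- s) (m p.2 : K) *: p.1 : X -> K^o) v =
        m (\sum_(p <- s) (p.1 v : K) *: p.2).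
      rewrite fct_sumE (lin_sum lm); apply: eq_bigr => p _.
      by rewrite (linZ lm) /= [RHS]mulrC.
    have e1 : n v = (m r)^-1 * (m v - (\sum_(p <- s) (m p.2 : K) *: p.1 : X -> K^o) v) by [].
    by rewrite e1 e (linB lm v).
  exists ((n, r) :: s); split.
    move=> p; rewrite inE => /predU1P[->/=|/sM//].
    apply: spanZ; rewrite addrC -[- _]scaleN1r; apply: spanZD; last exact: span_gen.
    rewrite big_seq; elim/big_ind : _ => [|u v Au Av|p' p's].
    - exact: span_0.
    - by rewrite -[u]scale1r; exact: spanZD.
    - by apply: spanZ; exact: sM.
  move=> y; rewrite big_cons/= nE => yl.
  move: yl; rewrite inE => /predU1P[->|/sl yE].
    by rewrite -/r mulVf// scale1r /r subrK.
  by rewrite yE subrr (lin0 lm) mulr0 scale0r add0r.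
have exact_on (phi : X -> K^o) (l : seq X) : linear phi ->
    exists2 psi, Defs.span M psi & forall x, x \in l -> psi x = phi x.
  move=> lphi.
  have [s [sM sl]] := rank l; exists (\sum_(p <- s) (phi p.2 : K) *: p.1).
    rewrite big_seq; elim/big_ind : _ => [|u v Au Av|p' p's].
    - exact: span_0.
    - by rewrite -[u]scale1r; exact: spanZD.
    - by apply: spanZ; exact: sM.
  move=> x /sl xE; rewrite fct_sumE -[in RHS]xE (lin_sum lphi).
  by apply: eq_bigr => p _; rewrite (linZ lphi) /= [RHS]mulrC.
move=> phi [lphi _]; rewrite closureEcvg /=.
pose G : set_system {ptws X -> K^o} := [set A | exists l : seq X, forall psi,
  Defs.span M psi -> (forall x, x \in l -> psi x = phi x) -> A psi].
have PG : ProperFilter G.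
  split.
    move=> [l Hl]; have [psi Mpsi e] := exact_on phi l lphi.
    exact: (Hl psi).
  split; first by exists [::].
    move=> A B [l Hl] [k Hk]; exists (l ++ k) => psi Mpsi e; split.
      by apply: Hl => // x xl; apply: e; rewrite mem_cat xl.
    by apply: Hk => // x xk; apply: e; rewrite mem_cat xk orbT.
  by move=> A B AB [l Hl]; exists l => psi Mpsi e; apply: AB; exact: Hl.
exists G; first exact: PG.
split; last by move=> A MA; exists [::] => psi Mpsi _; exact: MA.
have FG : Filter G by exact: (@filter_filter _ G PG).
apply: (proj2 (@pointwise_cvgP X K^o G phi FG)) => x A /nbhs_singleton Ax; exists [:: x] => psi _ e /=.
by rewrite e ?mem_head.
Qed.

End UniformSpaceFunctionals.

(** * The coordinate functions form a monotone Auerbach basis *)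

Section Basis.
Variables (R : realType) (K : numFieldType) (S : scalars R K).
Variables (d : Order.disp_t) (I : orderType d) (om : is_omega1 I).
Variable F : coherent_family I.
Local Notation N := (modulus S).
Local Notation X := (system_space S (pset F)).
Implicit Types (x y z : X) (t : point I).

Definition basis_vec (i : I) : X := coordX S (pset F) i.
Definition basis_coef (i : I) : X -> K^o := eval_at (Fin i 0).

Lemma basis_vecE i t : basis_vec i t = (`[< pset F t i >])%:R.
Proof. by []. Qed.

Lemma biorthogonal_basis : biorthogonal basis_vec basis_coef.
Proof.
split => [i|i j]; first exact: eval_at_dual.
rewrite /basis_coef /eval_at basis_vecE pset_single; congr (_%:R).
by congr nat_of_bool; apply/asboolP/eqP => [->|->].
Qed.

Lemma combX_span (s : seq (K * I)) (A : set I) :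
  (forall i, i \in map snd s -> A i) ->
  Defs.span (basis_vec @` A) (combX S (pset F) s).
Proof.
move=> sA; rewrite /combX big_seq; elim/big_ind : _ => [|u v Au Av|p ps].
- exact: span_0.
- by rewrite -[u]scale1r; exact: spanZD.
- by apply: spanZ; apply: span_gen; exists p.2 => //; apply: sA; exact: map_f.
Qed.

Lemma basis_span_dense : dense (Defs.span (range basis_vec)).
Proof.
apply: (@uelt_denseP _ _ S) => x e e0; have [s Hs] := combX_dense x e0.
by exists (combX S (pset F) s) => //; exact: combX_span.
Qed.

Lemma eval_empty x t : (forall i, ~ pset F t i) -> x t = 0.
Proof.
move=> t0; have := @system_eval_eq0 _ _ S _ _ (pset F) _ [:: t] (fun=> 1) id x.
rewrite !big_seq1 mul1r; apply => i.
by rewrite big_seq1 mul1r /coord; case: asboolP => // /t0.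
Qed.

Lemma exists_empty : exists t, forall i, ~ pset F t i.
Proof.
have [_ nc _] := om; have [i0] : [set: I] !=set0.
  by apply/set0P/eqP => I0; apply: nc; rewrite I0; exact: countable0.
move=> _; have [m _ mmin] := omega1_min (A := [set: I]) om (ex_intro _ i0 Logic.I).
by exists (Seg m) => i /=; rewrite ltNge mmin.
Qed.

Lemma eval_Fin x b n : x (Fin b n) = \sum_(i <- undup (F b n)) x (Fin i 0).
Proof.
pose r := None :: map Some (undup (F b n)).
pose t (o : option I) := if o is Some i then Fin i 0%N else Fin b n.
pose a (o : option I) : K := if o is Some i then -1 else 1.
have := @system_eval_eq0 _ _ S _ _ (pset F) _ r a t x.
rewrite big_cons big_map /= mul1r.
under eq_bigr => i _ do rewrite mulN1r.
rewrite sumrN => h; apply/eqP; rewrite -subr_eq0; apply/eqP; apply: h => j.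
rewrite big_cons big_map /= mul1r.
under eq_bigr => i _ do rewrite mulN1r /coord pset_single.
rewrite sumrN /coord /=; apply/eqP; rewrite subr_eq0; apply/eqP.
have [jF|jF] := boolP (j \in F b n); last first.
  rewrite asboolF; last by move=> h; apply: (negP jF).
  rewrite big_seq big1// => i; rewrite mem_undup => iF.
  by rewrite asboolF// => ji; rewrite ji iF in jF.
rewrite asboolT// (bigD1_seq j) ?undup_uniq ?mem_undup//= asboolT// big1 ?addr0//.
by move=> i ij; rewrite asboolF// => ji; rewrite ji eqxx in ij.
Qed.

(** Every member of the family is a limit of sets [F b n], or is empty, and elements
    of the space are continuous. *)
Lemma fin_norming x M : 0 <= M -> (forall b n, N (x (Fin b n)) <= M) -> supn x <= M.
Proof.
move=> M0 xM; apply: supn_le => // t; apply/ler_addgt0Pr => e e0.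
have [s Hs] := system_local x e0.
have [u [Nu ux]] : exists u, N (x u) <= M /\ N (x t - x u) <= e.
  have [[b [n bn]]|nt] := pset_finite_dense F t s.
    by exists (Fin b n); split => //; apply: Hs => i /bn.
  have [u u0] := exists_empty; exists u; split; first by rewrite eval_empty// modulus0.
  by apply: Hs => i /nt; have := u0 i; tauto.
rewrite -[x t](subrK (x u)) (le_trans (modulusD _ _ _))// addrC lerD//.
Qed.

Lemma basis_coef_separating x : (forall i, basis_coef i x = 0) -> x = 0.
Proof.
move=> x0; apply: (@supn0_eq0 _ _ S); apply: le_anti; rewrite supn_ge0 andbT.
apply: fin_norming => // b n; rewrite eval_Fin big1 ?modulus0// => i _.
exact: x0.
Qed.

Lemma markushevich : markushevich_basis basis_vec basis_coef.
Proof.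
split; [exact: biorthogonal_basis|exact: basis_span_dense|].
apply: (@separating_weak_star_dense _ _ S) => [_ [i _ <-]|x x0].
  exact: eval_at_linear.
by apply: basis_coef_separating => i; apply: x0; exists i.
Qed.

Lemma supn_basis_vec i : supn (basis_vec i) = 1.
Proof.
apply: le_anti; apply/andP; split.
  by apply: supn_le => // t; exact: coord_le1.
apply: le_trans (supn_ge _ (Fin i 0%N)).
by rewrite basis_vecE pset_single asboolT// modulus1.
Qed.

Lemma auerbach : auerbach_basis basis_vec basis_coef.
Proof.
split; first exact: markushevich.
move=> i; split; first by rewrite unormE supn_basis_vec rmorph1.
apply: (@dual_norm_eq1 _ _ S _ _ _ (basis_vec i)).
- exact: eval_at_linear.
- exact: eval_at_bounded.
- by rewrite supn_basis_vec.
- by rewrite biorthogonal_basis.2 eqxx modulus1.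
Qed.

Lemma span_coef_bounded phi : Defs.span (range basis_coef) phi ->
  linear phi /\ exists C, bounded_by (S := S) C phi.
Proof.
move: phi; apply: span_ind.
  split; first by move=> a x y; rewrite /= scaler0 addr0.
  by exists 0 => x; rewrite mul0r modulus0.
move=> c u v [i _ <-] [lv [C vC]]; split.
  move=> a x y; change (c * (a * x (Fin i 0%N) + y (Fin i 0%N)) + v (a *: x + y) =
    a * (c * x (Fin i 0%N) + v x) + (c * y (Fin i 0%N) + v y)).
  by rewrite lv /GRing.scale /=; ring.
exists (N c + C) => x.
change (N (c * x (Fin i 0%N) + v x) <= (N c + C) * supn x).
rewrite mulrDl (le_trans (modulusD _ _ _))// lerD//.
by rewrite modulusM ler_wpM2l ?modulus_ge0// supn_ge.
Qed.

Lemma eval_Fin_span b n : Defs.span (range basis_coef) (eval_at (Fin b n) : X -> K^o).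
Proof.
have -> : (eval_at (Fin b n) : X -> K^o) = \sum_(i <- undup (F b n)) basis_coef i.
  by apply: funext => x; rewrite fct_sumE; exact: eval_Fin.
by apply: span_sum => i; apply: span_gen; exists i.
Qed.

(** The evaluation at [F b n] is a sum of coefficient functionals. *)
Lemma one_norming_basis : one_norming basis_coef.
Proof.
move=> x.
have bnd phi : Defs.span (range basis_coef) phi /\ dual_norm phi <= 1 ->
    N (phi x) <= supn x.
  move=> [/span_coef_bounded[lphi [C bphi]] /(dual_norm_le1 lphi bphi)].
  by move=> /(_ x); rewrite mul1r.
have mem_ev b n : [set phi | Defs.span (range basis_coef) phi /\ dual_norm phi <= 1]
    (eval_at (Fin b n)).
  split; first exact: eval_Fin_span.
  apply/(@dual_norm_le1 _ _ S _ _ _ 1); [exact: eval_at_linear|exact: eval_at_bounded..].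
have hs : has_sup [set N (phi x) | phi in
    [set phi | Defs.span (range basis_coef) phi /\ dual_norm phi <= 1]].
  have [i0 _] : [set: I] !=set0.
    have [_ nc _] := om.
    by apply/set0P/eqP => I0; apply: nc; rewrite I0; exact: countable0.
  split; first by exists (N (x (Fin i0 0%N))), (eval_at (Fin i0 0%N)).
  by exists (supn x) => _ [phi /bnd h <-].
rewrite (@supremum_norm _ _ S _ _ (fun phi => phi x) (supn x)); last 2 first.
- by have [_ [phi h _]] := hs.1; exists phi.
- exact: bnd.
rewrite unormE emb_le; apply: fin_norming.
  have [_ [phi h _]] := hs.1; apply: le_trans (modulus_ge0 S (phi x)) _.
  by apply: sup_ubound; [exact: hs.2|exists phi].
by move=> b n; apply: sup_ubound; [exact: hs.2|exists (eval_at (Fin b n))].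
Qed.

Lemma span_cut (A : set I) x t u : (forall i, A i -> (pset F t i <-> pset F u i)) ->
  closure (Defs.span (basis_vec @` A)) x -> x t = x u.
Proof.
move=> tu cx; apply/eqP; rewrite -subr_eq0; apply/eqP; apply: (@modulus_eq0 _ _ S).
apply: le_anti; rewrite modulus_ge0 andbT; apply/ler_addgt0Pr => e e0; rewrite add0r.
have [v Av xv] := uelt_closureP cx (divr_gt0 e0 (ltr0Sn _ 1)).
have vtu : v t = v u.
  move: v Av {xv}; apply: span_ind => // c _ v [i Ai <-] vtu.
  rewrite !ufunD !ufunZ vtu !basis_vecE; congr (_ * _%:R + _).
  by congr nat_of_bool; apply: asbool_equiv_eq; exact: tu.
have -> : x t - x u = (x - v) t - (x - v) u by rewrite !ufunB vtu opprB addrA subrK.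
rewrite (le_trans (modulusD _ _ _))// modulusN [leRHS]splitr.
by rewrite lerD// (le_trans (supn_ge _ _) xv).
Qed.

(** Cutting a set at [a] does not change the value of the head [y] there, and
    annihilates the tail [z]. *)
Lemma basis_constant1 : basis_constant_le basis_vec 1.
Proof.
move=> a y z cy cz; rewrite mul1r !unormE emb_le; apply: supn_le => [|t].
  exact: supn_ge0.
have [u _ uE] := pset_cut om F t a.
have yE : y t = y u.
  apply: span_cut cy => i ia; rewrite uE; split => [ti|[]//]; by split.
have zE : z u = 0.
  have [t0 t0E] := exists_empty; rewrite -(eval_empty z t0E).
  apply: span_cut cz => i /= ai; rewrite uE; split => [[_ /=]|/t0E//].
  by rewrite ltNge ai.
by rewrite yE -[y u]addr0 -zE -ufunD supn_ge.
Qed.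

Lemma monotone_basis : monotone_long_schauder_basis basis_vec.
Proof.
split; last exact: basis_constant1.
split; last exact: basis_span_dense.
split; last by exists 1; [exact: lexx|exact: basis_constant1].
move=> i; apply/eqP => h; have := supn_basis_vec i.
by rewrite h -re_unorm normr0 raddf0 => /eqP; rewrite eq_sym oner_eq0.
Qed.

End Basis.

(** * Failure of weak compact generation *)

Section NotWCG.
Variables (R : realType) (K : numFieldType) (S : scalars R K).
Variables (d : Order.disp_t) (I : orderType d) (om : is_omega1 I).
Variable F : coherent_family I.
Local Notation N := (modulus S).
Local Notation X := (system_space S (pset F)).
Implicit Types (x y z : X) (t : point I).

Lemma inv_natS_small (e : R) : 0 < e -> exists k, k.+1%:R^-1 <= e.
Proof.
move=> e0; exists (Num.truncn e^-1).
by rewrite -[leRHS]invrK lef_pV2 ?posrE ?invr_gt0// ltW// truncnS_gt.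
Qed.

(** The estimates of an element are decided by countably many memberships, and
    countably many indices are bounded. *)
Lemma local_below (u : nat -> X) : exists b, forall n e, 0 < e ->
  exists s : seq I, (forall i, i \in s -> (i < b)%O) /\
  forall t v, (forall i, i \in s -> (pset F t i <-> pset F v i)) ->
  N (u n t - u n v) <= e.
Proof.
have /choice[s Hs] : forall p : nat * nat, exists s : seq I, forall t v,
    (forall i, i \in s -> (pset F t i <-> pset F v i)) ->
    N (u p.1 t - u p.1 v) <= p.2.+1%:R^-1.
  by move=> p; apply: system_local; rewrite invr_gt0.
have cs : countable (\bigcup_(p in [set: nat * nat]) [set` s p]).
  by apply: bigcup_countable => // p _; apply: finite_set_countable; exact: finite_seq.
have [b Hb] := omega1_bound om cs.
exists b => n e e0; have [k ke] := inv_natS_small e0; exists (s (n, k)); split.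
  by move=> i si; apply: Hb; exists (n, k).
by move=> t v tv; apply: le_trans ke; exact: (Hs (n, k)).
Qed.

Lemma eval_below x : exists b, forall t v,
  (forall i, (i < b)%O -> (pset F t i <-> pset F v i)) -> x t = x v.
Proof.
have [b Hb] := local_below (fun=> x); exists b => t v tv.
apply/eqP; rewrite -subr_eq0; apply/eqP; apply: (@modulus_eq0 _ _ S).
apply: le_anti; rewrite modulus_ge0 andbT; apply/ler_addgt0Pr => e e0; rewrite add0r.
have [s [sb Hs]] := Hb 0%N e e0; apply: Hs => i /sb; exact: tv.
Qed.

Lemma weak_nbhs (t : point I) (w : X) e : 0 < e ->
  nbhs (w : initial_topology (@evaluation K X)) [set y : X | N (w t - y t) < e].
Proof.
move=> e0.
pose phi : set_type (Defs.dual (X := X)) :=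
  exist _ (eval_at t : X -> K^o) (mem_set (@eval_at_dual _ _ S _ _ t)).
have ce : {for (w : initial_topology (@evaluation K X)),
    continuous (fun y : initial_topology (@evaluation K X) => evaluation y phi)}.
  apply: (@continuous_comp _ _ _ (@evaluation K X : initial_topology (@evaluation K X) -> _)
    (fun g : {ptws (Defs.dual (X := X)) -> K^o} => g phi)).
    exact: initial_continuous.
  exact: (@proj_continuous _ (fun=> K^o) phi).
have : nbhs (evaluation w phi : K^o) [set z : K | N (w t - z) < e].
  apply/nbhs_ballP; exists (emb S e); first by rewrite /= emb_gt0.
  by move=> z; rewrite /ball/= /ball/= -(emb_modulus S) emb_lt.
by move=> /ce.
Qed.

(** The partial sums of any tuple are eventually equal to its total sums; were no
    finite set of indices sufficient up to [e], an ultrafilter limit of bad tuples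
    would violate this. Tuples are needed because a linear combination requires the
    same index for all its vectors. *)
Lemma compact_tuple_tail (W : set X) n (e : R) : weakly_compact W -> 0 < e ->
  exists s : seq I, forall w : 'I_n -> X, (forall i, W (w i)) ->
  exists2 c, c \in s & forall i, N (w i (Seg c) - w i Top) < e.
Proof.
move=> cW e0; apply: contrapT => nos.
have /choice[w Hw] : forall s : seq I, exists w : 'I_n -> X, (forall i, W (w i)) /\
    forall c, c \in s -> ~ forall i, N (w i (Seg c) - w i Top) < e.
  move=> s; apply: contrapT => now; apply: nos; exists s => w Ww.
  apply: contrapT => noc; apply: now; exists w; split => // c cs h.
  by apply: noc; exists c.
pose G : set_system (seq I) := [set A | exists s0 : seq I, forall s : seq I,
  {subset s0 <= s} -> A s].
have PG : ProperFilter G.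
  split; first by move=> [s0 /(_ s0)]; apply.
  split; first by exists [::].
    move=> A B [s Hs] [r Hr]; exists (s ++ r) => q qs; split.
      by apply: Hs => x xs; apply: qs; rewrite mem_cat xs.
    by apply: Hr => x xs; apply: qs; rewrite mem_cat xs orbT.
  by move=> A B AB [s Hs]; exists s => q /Hs/AB.
have [U [UU GU]] := ultraFilterLemma PG.
have PU : ProperFilter U by exact: ultra_proper.
have /choice[l Hl] : forall i, exists l : X, forall t e, 0 < e ->
    U [set s | N (l t - w s i t) < e].
  move=> i; have [|l [_ cl]] := cW ((fun s => w s i) @ U) _.
    by apply: GU; exists [::] => s _; exact: (Hw s).1.
  exists l => t e1 e10.
  have [//|UC] := in_ultra_setVsetC [set s | N (l t - w s i t) < e1] UU.
  pose A := (fun s => w s i) @` ~` [set s | N (l t - w s i t) < e1].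
  have UA : U [set s | A (w s i)] by apply: filterS UC => s ns; exists s.
  have [y [[s ns sy] /= ly]] := cl A _ UA (weak_nbhs t l e10).
  by exfalso; apply: ns; rewrite /= sy.
have /choice[b Hb] := fun i => eval_below (l i).
have [c Hc] : exists c, forall i, (b i <= c)%O.
  have cb : countable (range b) by apply: finite_set_countable; exact: finite_image.
  have [c Hc] := omega1_bound om cb.
  by exists c => i; apply: ltW; apply: Hc; exists i.
have lc i : l i (Seg c) = l i Top.
  by apply: Hb => j jb; split => // _; exact: lt_le_trans (Hc i).
have e2 : 0 < e / 2 by rewrite divr_gt0.
have : U [set s : seq I | c \in s /\ forall i, N (w s i (Seg c) - w s i Top) < e].
  apply: (@filterS _ _ _ ([set s : seq I | c \in s] `&` [set s | forall i,
    N (l i (Seg c) - w s i (Seg c)) < e / 2 /\ N (l i Top - w s i Top) < e / 2])).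
    move=> s [cs h]; split => // i; have [/= h1 h2] := h i.
    have -> : w s i (Seg c) - w s i Top =
        (l i Top - w s i Top) - (l i (Seg c) - w s i (Seg c)).
      by rewrite lc; ring.
    by rewrite (le_lt_trans (modulusD _ _ _))// modulusN [ltRHS]splitr ltrD.
  apply: filterI; first by apply: GU; exists [:: c] => s; apply; exact: mem_head.
  by apply: filter_forall => i; apply: filterI; apply: Hl.
by move=> /filter_ex[s [cs h]]; exact: (Hw s).2 cs h.
Qed.

(** If a weakly compact set generated the space, a countable set of partial sum
    functionals would have the total sum functional in its weak-star closure;
    but these functionals all vanish on a basis vector beyond their indices. *)
Lemma not_wcg : ~ weakly_compactly_generated X.
Proof.
move=> [W cW dW].
have /choice[s Hs] : forall p : nat * nat, exists s : seq I,
    forall w : 'I_p.1 -> X, (forall i, W (w i)) ->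
    exists2 c, c \in s & forall i, N (w i (Seg c) - w i Top) < p.2.+1%:R^-1.
  by move=> p; apply: compact_tuple_tail => //; rewrite invr_gt0.
have cs : countable (\bigcup_(p in [set: nat * nat]) [set` s p]).
  by apply: bigcup_countable => // p _; apply: finite_set_countable; exact: finite_seq.
have [b Hb] := omega1_bound om cs.
pose f : X := basis_vec S F b.
have [v [bv Wv]] : ball f (emb S (1 / 4)) `&` Defs.span W !=set0.
  apply: dW; last exact: ball_open.
  by exists f; apply: ballxx; rewrite emb_gt0.
have e4 : 0 < emb S (1 / 4) by rewrite emb_gt0.
move/(uelt_ballP _ _ e4): bv; rewrite re_emb => fv.
have [n [c [w [Ww vE]]]] := Wv.
pose M := \sum_(i < n) N (c i).
have M0 : 0 <= M by apply: sumr_ge0 => i _; exact: modulus_ge0.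
have [k Mk] : exists k, M * k.+1%:R^-1 <= 1 / 4.
  have M1 : 0 < M + 1 by lra.
  have [k hk] := inv_natS_small (divr_gt0 (divr_gt0 (@ltr01 R) (ltr0Sn R 3)) M1).
  exists k; apply: le_trans (ler_wpM2l M0 hk) _.
  have : M / (M + 1) <= 1 by rewrite ler_pdivrMr// mul1r; lra.
  by rewrite mulrCA; lra.
have [g gs Hg] := Hs (n, k) w Ww.
have gb : (g < b)%O by apply: Hb; exists (n, k).
have vg : N (v (Seg g) - v Top) <= 1 / 4.
  rewrite vE !ufun_sum -sumrB; apply: le_trans (modulus_sum _ _ _ _) _.
  apply: le_trans Mk; rewrite mulr_suml; apply: ler_sum => i _.
  by rewrite !ufunZ -mulrBr modulusM ler_wpM2l ?modulus_ge0// ltW// Hg.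
have f0 : f (Seg g) = 0 by rewrite basis_vecE asboolF//= => /(lt_trans gb); rewrite ltxx.
have f1 : f Top = 1 by rewrite basis_vecE asboolT.
have := supn_ge (f - v) (Seg g); have := supn_ge (f - v) Top.
rewrite !ufunB f0 f1 => h1 h2.
have e1 : (1 : K) = (1 - v Top) - (v (Seg g) - v Top) - (0 - v (Seg g)) by ring.
have h3 := modulusD S (1 - v Top - (v (Seg g) - v Top)) (- (0 - v (Seg g))).
have h4 := modulusD S (1 - v Top) (- (v (Seg g) - v Top)).
rewrite -e1 !modulusN modulus1 in h3; rewrite modulusN in h4.
by clear gb e4; lra.
Qed.

End NotWCG.

(** * Bounded functionals on countable compacta are nearly finite combinations of evaluations *)

Section RealScalars.
Variable R : realType.

Definition real_scalars : scalars R R.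
Proof.
apply: (@Scalars R R idfun idfun \0 0) => //=.
- by move=> r z; rewrite mulr0.
- by move=> z; rewrite mul0r addr0.
- by rewrite normr0.
- by move=> z; rewrite normr0.
Defined.

Lemma modulus_real z : modulus real_scalars z = `|z|. Proof. by []. Qed.
End RealScalars.

Section BoundedFunctions.
Variables (R : realType) (T : Type).
Local Notation S := (real_scalars R).

Definition bounded_fun (x : T -> R) : Prop := exists M, forall t, modulus S (x t) <= M.

Lemma bounded_fun0 : bounded_fun (fun=> 0).
Proof. by exists 0 => t; rewrite modulus0. Qed.

Lemma bounded_funZD a x y : bounded_fun x -> bounded_fun y ->
  bounded_fun (fun t => a * x t + y t).
Proof.
move=> [A xA] [B yB]; exists (modulus S a * A + B) => t.
rewrite (le_trans (modulusD _ _ _))// lerD// modulusM ler_wpM2l//.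
exact: modulus_ge0.
Qed.

Lemma bounded_fun_closed x : (forall e : R, 0 < e ->
  exists2 y, bounded_fun y & forall t, modulus S (x t - y t) <= e) -> bounded_fun x.
Proof.
move=> /(_ 1 ltr01)[y [M yM] xy]; exists (1 + M) => t.
by rewrite -[x t](subrK (y t)) (le_trans (modulusD _ _ _))// lerD.
Qed.

Definition bounded_uspace : uspace S T :=
  @USpace _ _ S T bounded_fun bounded_fun0 bounded_funZD (fun x h => h)
    bounded_fun_closed.

Definition bfun := uelt bounded_uspace.
HB.instance Definition _ := CompleteNormedModule.on bfun.

Lemma bfun_ge (x : bfun) t : `|x t| <= supn x.
Proof. by have := supn_ge x t; rewrite modulus_real. Qed.

Lemma bfun_le (x : bfun) M : 0 <= M -> (forall t, `|x t| <= M) -> supn x <= M.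
Proof. by move=> M0 xM; apply: supn_le => // t; rewrite modulus_real. Qed.

Lemma bfunZE (a : R) (x : bfun) t : (a *: x) t = a * x t. Proof. by []. Qed.

Lemma mk_bfun (x : T -> R) M : (forall t, `|x t| <= M) ->
  exists y : bfun, forall t, y t = x t.
Proof.
move=> xM; have Ex : x \in uspred bounded_uspace by apply/asboolP; exists M.
by exists (UElt Ex).
Qed.

Lemma restr_ex (A : set T) (x : bfun) :
  exists y : bfun, forall t, y t = if `[< A t >] then x t else 0.
Proof.
apply: (@mk_bfun _ (supn x)) => t; case: ifP => _; first exact: bfun_ge.
by rewrite normr0 supn_ge0.
Qed.

Definition restr A x : bfun := xget 0 [set y : bfun | forall t, y t = if `[< A t >] then x t else 0].

Lemma restrE A (x : bfun) t : restr A x t = if `[< A t >] then x t else 0.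
Proof. by have := xgetPex 0 (restr_ex A x); apply. Qed.

Lemma one_ex : exists y : bfun, forall t, y t = 1.
Proof. by apply: (@mk_bfun _ 1) => t; rewrite normr1. Qed.

Definition bone : bfun := xget 0 [set y : bfun | forall t, y t = 1].

Lemma boneE t : bone t = 1.
Proof. by have := xgetPex 0 one_ex; apply. Qed.

End BoundedFunctions.

Section AtomicApproximation.
Variables (R : realType) (T : Type).
Local Notation W := (bfun R T).
Implicit Types (g h y : W) (A B C : set T).
Variables (L : W -> R) (M : R).
Hypothesis LD : forall g h, L (g + h) = L g + L h.
Hypothesis LZ : forall (a : R) g, L (a *: g) = a * L g.
Hypothesis M_ge0 : 0 <= M.
Hypothesis LM : forall g, L g <= M * supn g.

Lemma L_N g : L (- g) = - L g. Proof. by rewrite -scaleN1r LZ mulN1r. Qed.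
Lemma L_B g h : L (g - h) = L g - L h. Proof. by rewrite LD L_N. Qed.
Lemma L_0 : L 0 = 0. Proof. by rewrite -(scale0r 0) LZ mul0r. Qed.

Lemma L_sum (J : Type) (s : seq J) (G : J -> W) :
  L (\sum_(j <- s) G j) = \sum_(j <- s) L (G j).
Proof. by elim/big_ind2 : _ => // [|x a y b <- <-]; [exact: L_0|exact: LD]. Qed.

(** The total variation of [L], seen as a finitely additive measure; the atom at [p j]
    is its infimum over the neighbourhoods [E j m]. *)
Definition supported A g := forall t, (~ A t -> g t = 0) /\ `|g t| <= 1.
Definition variation A := sup (L @` supported A).

Lemma variation_has_sup A : has_sup (L @` supported A).
Proof.
split; first by exists (L 0), 0 => // t; rewrite ufun0 normr0.
exists M => _ [g sg <-]; apply: le_trans (LM g) _; rewrite ler_piMr//.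
by apply: bfun_le => // t; exact: (sg t).2.
Qed.

Lemma variation_ge A g : supported A g -> L g <= variation A.
Proof. by move=> sg; apply: sup_ubound; [exact: (variation_has_sup A).2|exists g]. Qed.

Lemma variation_ge0 A : 0 <= variation A.
Proof. by rewrite -L_0; apply: variation_ge => t; rewrite ufun0 normr0. Qed.

Lemma variation_leM A : variation A <= M.
Proof.
apply: ge_sup; first exact: (variation_has_sup A).1.
move=> _ [g sg <-]; apply: le_trans (LM g) _; rewrite ler_piMr//.
by apply: bfun_le => // t; exact: (sg t).2.
Qed.

Lemma variation_bound A g (c : R) : 0 <= c -> (forall t, A t -> `|g t| <= c) ->
  (forall t, ~ A t -> g t = 0) -> `|L g| <= c * variation A.
Proof.
move=> c0 gc gA.
have gc' t : `|g t| <= c by have [/gc//|/gA->] := pselect (A t); rewrite normr0.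
move: c0; rewrite le_eqVlt => /predU1P[c0|c0].
  have -> : g = 0.
    by apply: uelt_eqP => t; apply/eqP; rewrite -normr_le0 c0 gc'.
  by rewrite L_0 normr0 -c0 mul0r.
have le h : (forall t, `|h t| <= c) -> (forall t, ~ A t -> h t = 0) ->
    L h <= c * variation A.
  move=> hc hA; rewrite -ler_pdivrMl// -LZ; apply: variation_ge => t.
  rewrite bfunZE; split => [/hA->|]; first by rewrite mulr0.
  by rewrite normrM gtr0_norm ?invr_gt0// ler_pdivrMl// mulr1.
rewrite ler_norml lerNl -L_N !le// => t; rewrite ufunN; first by rewrite normrN.
by move/gA ->; rewrite oppr0.
Qed.

Lemma variation_super A B C : (forall t, A t -> ~ B t) -> A `<=` C -> B `<=` C ->
  variation A + variation B <= variation C.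
Proof.
move=> dAB AC BC; rewrite -lerBrDr; apply: ge_sup; first exact: (variation_has_sup A).1.
move=> _ [g sg <-]; rewrite lerBrDr -lerBrDl.
apply: ge_sup; first exact: (variation_has_sup B).1.
move=> _ [h sh <-]; rewrite lerBrDl -LD; apply: variation_ge => t; rewrite ufunD.
have [At|nAt] := pselect (A t).
  rewrite (sh t).1 ?addr0; last exact: dAB.
  by split; [move=> nC; case: nC; exact: AC|exact: (sg t).2].
rewrite (sg t).1// add0r; split; last exact: (sh t).2.
by move=> nCt; apply: (sh t).1 => /BC.
Qed.

Variables (p : nat -> T) (E : nat -> nat -> set T).
Hypothesis E_decr : forall j m k, (m <= k)%N -> E j k `<=` E j m.
Hypothesis E_cover : forall s : nat -> nat, exists n, forall t,
  exists2 j, (j < n)%N & E j (s j) t.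

Definition continuous_at_points y := forall j e, 0 < e ->
  exists m, forall t, E j m t -> `|y t - y (p j)| <= e.

Lemma variation_stationary j (e : R) : 0 < e -> exists m, forall k, (m <= k)%N ->
  variation (E j m) - variation (E j k) <= e.
Proof.
move=> e0; pose B := [set variation (E j m) | m in [set: nat]].
have hB : has_inf B.
  split; first by exists (variation (E j 0%N)), 0%N.
  by exists 0 => _ [m _ <-]; exact: variation_ge0.
have [_ [m _ <-] hm] := inf_adherent e0 hB.
exists m => k mk; have : inf B <= variation (E j k) by apply: ge_inf; [exact: hB.2|exists k].
lra.
Qed.

Lemma sum_geometric_half n : \sum_(j < n) (2^-1 : R) ^+ j.+1 = 1 - 2^-1 ^+ n.
Proof.
elim: n => [|n IH]; first by rewrite big_ord0 expr0 subrr.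
rewrite big_ord_recr/= IH [2^-1 ^+ n.+1]exprS.
by set x := _ ^+ n; field.
Qed.

(** Around each [p j] a neighbourhood is chosen whose variation exceeds the atom by at
    most [dl j], a summable error. Finitely many of them cover; made disjoint, they
    split [y] into pieces, and on each piece [y] may be replaced by [y (p j)], because
    the variation away from a smaller neighbourhood of [p j] is at most [dl j]. *)
Lemma atomic_approx_real (e : R) : 0 < e -> exists n (q : nat -> R), forall y,
  continuous_at_points y ->
  `|L y - \sum_(j < n) q j * y (p j)| <= e * supn y.
Proof.
move=> e0.
pose dl j : R := e / 2 * 2^-1 ^+ j.+1.
have dl0 j : 0 < dl j by rewrite mulr_gt0 ?divr_gt0// exprn_gt0// invr_gt0.
have /choice[s Hs] := fun j => variation_stationary j (dl0 j).
have [n cov] := E_cover s.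
(* the points whose first chosen neighbourhood is the [j]-th *)
pose D j t := E j (s j) t /\ forall i, (i < j)%N -> ~ E i (s i) t.
have DE t : exists j0 : 'I_n, D j0 t /\ forall j : 'I_n, D j t -> j = j0.
  have [j1 j1n Ej1] := cov t.
  have ex : exists j, `[< E j (s j) t >] by exists j1; apply/asboolP.
  have /asboolP Ej0 := ex_minnP ex; move: Ej0.
  case: (ex_minnP ex) => j0 /asboolP Ej0 j0min _.
  have j0n : (j0 < n)%N by apply: leq_ltn_trans j1n; apply: j0min; apply/asboolP.
  have D0 : D j0 t.
    split => // i ij /(introT (asboolP _))/j0min; by rewrite leqNgt ij.
  exists (Ordinal j0n); split => // j [Ej jmin]; apply/val_inj/eqP => /=.
  rewrite eqn_leq (j0min j) ?andbT; last exact/asboolP.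
  by rewrite leqNgt; apply/negP => j0j; exact: jmin j0j Ej0.
pose q j := L (restr (D j) (bone R T)).
exists n, q => y cy.
have yE : y = \sum_(j < n) restr (D j) y.
  apply: uelt_eqP => t; rewrite ufun_sum; have [j0 [Dj0 uj0]] := DE t.
  rewrite (bigD1 j0)//= restrE asboolT// big1 ?addr0// => j jj0.
  by rewrite restrE asboolF// => /uj0 jE; rewrite jE eqxx in jj0.
have each (j : 'I_n) : `|L (restr (D j) y) - q j * y (p j)| <= 2 * supn y * dl j.
  have [z [zE ->]] : exists z : W,
      (forall t, z t = if `[< D j t >] then y t - y (p j) else 0) /\
      L (restr (D j) y) - q j * y (p j) = L z.
    exists (restr (D j) y - y (p j) *: restr (D j) (bone R T)).
    split; last by rewrite L_B LZ mulrC.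
    move=> t; rewrite ufunB bfunZE !restrE boneE.
    by case: ifP => _; rewrite ?mulr1// mulr0 subr0.
  apply/ler_addgt0Pr => eta eta0.
  have eM : 0 < eta / (M + 1) by rewrite divr_gt0// ltr_wpDl.
  have [m Hm] := cy j _ eM; pose k := maxn m (s j).
  have zsplit : z = restr (E j k) z + restr (~` E j k) z.
    apply: uelt_eqP => t; rewrite ufunD !restrE; have [Et|nEt] := pselect (E j k t).
      by rewrite (asboolT Et) (@asboolF ((~` E j k) t)) ?addr0//; apply.
    by rewrite (asboolF nEt) (@asboolT ((~` E j k) t)) ?add0r.
  rewrite zsplit LD (le_trans (ler_normD _ _))// addrC lerD//.
    apply: le_trans (variation_bound (A := D j `&` ~` E j k) (c := 2 * supn y) _ _ _) _.
    - by rewrite mulr_ge0// supn_ge0.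
    - move=> t [Dt nEt]; rewrite restrE asboolT// zE asboolT//.
      rewrite (le_trans (ler_normB _ _))// mulr_natl mulr2n.
      by rewrite lerD// bfun_ge.
    - move=> t nDE; rewrite restrE; case: asboolP => // nEt.
      by rewrite zE asboolF// => Dt; apply: nDE.
    rewrite ler_wpM2l ?mulr_ge0 ?supn_ge0//.
    have := Hs j k (leq_maxr _ _); have := @variation_super (D j `&` ~` E j k) (E j k) (E j (s j)).
    move=> h1 h2; rewrite -(lerD2r (variation (E j k))).
    apply: le_trans (h1 _ _ _) _ => [t [_ //]|t [[]//]| |].
      exact: E_decr (leq_maxr _ _).
    by rewrite -lerBlDr.
  apply: le_trans (variation_bound (A := setT) (c := eta / (M + 1)) _ _ _) _ => //.
  - exact: ltW.
  - move=> t _; rewrite restrE; case: asboolP => [Et|_]; last by rewrite normr0 ltW.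
    rewrite zE; case: ifP => _; last by rewrite normr0 ltW.
    by apply: Hm; exact: E_decr (leq_maxl _ _) _ Et.
  - by move=> t nT; case: nT.
  have M1 : 0 < M + 1 by rewrite ltr_wpDl.
  rewrite mulrAC ler_pdivrMr//; apply: ler_wpM2l; first exact: ltW.
  by apply: le_trans (variation_leM _) _; rewrite lerDl.
rewrite {1}yE L_sum -sumrB; apply: le_trans (ler_norm_sum _ _ _) _.
apply: le_trans (ler_sum _ (fun j _ => each j)) _.
rewrite -mulr_sumr -mulr_sumr sum_geometric_half.
have h : 0 <= (2^-1 : R) ^+ n by rewrite exprn_ge0// invr_ge0.
have := mulr_ge0 (mulr_ge0 (ltW e0) (supn_ge0 y)) h; lra.
Qed.

(** Rational coefficients suffice, so countably many combinations approximate all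
    bounded functionals. *)
Lemma atomic_approx (e : R) : 0 < e -> exists q : seq rat, forall y,
  continuous_at_points y ->
  `|L y - \sum_(j < size q) ratr q`_j * y (p j)| <= e * supn y.
Proof.
move=> e0; have e2 : 0 < e / 2 by rewrite divr_gt0.
have [n [q Hq]] := atomic_approx_real e2.
pose dl : R := e / 2 / n.+1%:R.
have dl0 : 0 < dl by rewrite divr_gt0.
have /choice[r Hr] : forall j, exists r : rat, `|q j - ratr r| <= dl.
  move=> j; have qdl : q j - dl < q j + dl by lra.
  have [r] := rat_in_itvoo qdl.
  by rewrite in_itv/= => /andP[h1 h2]; exists r; rewrite ler_norml; lra.
exists (mkseq r n) => y cy; rewrite size_mkseq.
under eq_bigr => j _ do rewrite nth_mkseq//.
have -> : L y - \sum_(j < n) ratr (r j) * y (p j) =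
    (L y - \sum_(j < n) q j * y (p j)) + \sum_(j < n) (q j - ratr (r j)) * y (p j).
  under [X in _ = _ + X]eq_bigr => j _ do rewrite mulrBl.
  by rewrite sumrB addrA subrK.
rewrite (le_trans (ler_normD _ _))// [e in leRHS]splitr mulrDl lerD ?Hq//.
apply: le_trans (ler_norm_sum _ _ _) _.
apply: (@le_trans _ _ (\sum_(j < n) dl * supn y)).
  by apply: ler_sum => j _; rewrite normrM ler_pM ?bfun_ge.
rewrite sumr_const card_ord -[leLHS]mulr_natl mulrA ler_wpM2r ?supn_ge0//.
rewrite /dl mulrCA ler_piMr ?ltW// ltr_pdivrMr// mul1r ltr_nat//.
Qed.

End AtomicApproximation.

(** * Separable pieces have separable duals *)

Section SeparableDual.
Variables (R : realType) (K : numFieldType) (S : scalars R K).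
Variables (d : Order.disp_t) (I : orderType d) (om : is_omega1 I).
Variable F : coherent_family I.
Local Notation N := (modulus S).
Local Notation X := (system_space S (pset F)).
Local Notation W := (bfun R (point I * bool)%type).
Implicit Types (x y z : X) (t : point I).

Definition real_part (c : bool) (z : K) : R := if c then re S z else im S z.

Lemma real_partD c (z w : K) : real_part c (z + w) = real_part c z + real_part c w.
Proof. by case: c; exact: raddfD. Qed.

Lemma real_partB c (z w : K) : real_part c (z - w) = real_part c z - real_part c w.
Proof. by case: c; exact: raddfB. Qed.

Lemma real_part_emb c (r : R) (z : K) : real_part c (emb S r * z) = r * real_part c z.
Proof. by case: c; [exact: re_embM|exact: im_embM]. Qed.

Lemma real_part_le c (z : K) : `|real_part c z| <= N z.
Proof. by case: c; [exact: re_le|exact: im_le]. Qed.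

Lemma real_copy_ex x : exists w : W, forall u, w u = real_part u.2 (x u.1).
Proof.
apply: (@mk_bfun _ _ _ (supn x)) => u.
exact: le_trans (real_part_le _ _) (supn_ge _ _).
Qed.

(** The space seen as a space of real functions, with an equivalent norm. *)
Definition real_copy x : W := xget 0 [set w : W | forall u, w u = real_part u.2 (x u.1)].

Lemma real_copyE x u : real_copy x u = real_part u.2 (x u.1).
Proof. by have := xgetPex 0 (real_copy_ex x); apply. Qed.

Lemma real_copyD x y : real_copy (x + y) = real_copy x + real_copy y.
Proof. by apply: uelt_eqP => u; rewrite ufunD !real_copyE ufunD real_partD. Qed.

Lemma real_copyZ (r : R) x : real_copy (emb S r *: x) = r *: real_copy x.
Proof. by apply: uelt_eqP => u; rewrite bfunZE !real_copyE ufunZ real_part_emb. Qed.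

Lemma real_copyN x : real_copy (- x) = - real_copy x.
Proof.
by rewrite -scaleN1r -(rmorphN1 (emb S)) real_copyZ scaleN1r.
Qed.

Lemma real_copy_le x : supn (real_copy x) <= supn x.
Proof.
apply: bfun_le => [|u]; first exact: supn_ge0.
by rewrite real_copyE; exact: le_trans (real_part_le _ _) (supn_ge _ _).
Qed.

Lemma real_copy_ge x : supn x <= 2 * supn (real_copy x).
Proof.
apply: supn_le => [|t]; first by rewrite mulr_ge0// supn_ge0.
rewrite (le_trans (modulus_le_reim _ _))// mulr_natl mulr2n lerD//.
  by have := bfun_ge (real_copy x) (t, true); rewrite real_copyE.
by have := bfun_ge (real_copy x) (t, false); rewrite real_copyE.
Qed.

(** The closed subspace of the elements that are continuous functions of the trace on
    the indices below [b]. *)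
Definition decided_below (b : I) : set X := [set x | forall e : R, 0 < e ->
  exists s : seq I, (forall i, i \in s -> (i < b)%O) /\
  forall t v, (forall i, i \in s -> (pset F t i <-> pset F v i)) ->
  N (x t - x v) <= e].

Lemma decided_belowB b x y : decided_below b x -> decided_below b y ->
  decided_below b (x - y).
Proof.
move=> bx hy e e0; have e2 : 0 < e / 2 by rewrite divr_gt0.
have [s [sb Hs]] := bx _ e2; have [r [rb Hr]] := hy _ e2; exists (s ++ r); split.
  by move=> i; rewrite mem_cat => /orP[/sb|/rb].
move=> t v tv.
have -> : (x - y) t - (x - y) v = (x t - x v) - (y t - y v) by rewrite !ufunB; ring.
rewrite (le_trans (modulusD _ _ _))// modulusN [leRHS]splitr lerD//.
  by apply: Hs => i si; apply: tv; rewrite mem_cat si.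
by apply: Hr => i si; apply: tv; rewrite mem_cat si orbT.
Qed.

Lemma decided_below_closed b x : (forall e : R, 0 < e ->
  exists2 y, decided_below b y & supn (x - y) <= e) -> decided_below b x.
Proof.
move=> hx e e0; have e3 : 0 < e / 3 by rewrite divr_gt0.
have [y hy xy] := hx _ e3; have [s [sb Hs]] := hy _ e3; exists s; split => // t v tv.
have -> : x t - x v = (x - y) t + (y t - y v) - (x - y) v by rewrite !ufunB; ring.
have h1 := supn_ge (x - y) t; have h2 := supn_ge (x - y) v.
have h3 := Hs t v tv.
have h4 := modulusD S ((x - y) t + (y t - y v)) (- (x - y) v).
have h5 := modulusD S ((x - y) t) (y t - y v).
rewrite modulusN in h4; lra.
Qed.

(** Compactness of the set of traces on the indices below [b]: an ultrafilter limit of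
    uncovered traces is again a trace, by [pset_closed], so it is some [p j], whose
    neighbourhood covers almost all of them. *)
Lemma trace_cover b (a : nat -> I) (p : nat -> point I * bool) :
  (forall i, (i < b)%O -> exists k, a k = i) -> (forall k, (a k < b)%O) ->
  (forall u, points_below b u.1 -> exists j, p j = u) ->
  forall s : nat -> nat, exists n, forall u : point I * bool,
  exists2 j, (j < n)%N & u.2 = (p j).2 /\ forall k, (k < s j)%N ->
    (pset F u.1 (a k) <-> pset F (p j).1 (a k)).
Proof.
move=> asurj ab psurj s; apply: contrapT => non.
have /choice[u Hu] : forall n, exists u : point I * bool, forall j, (j < n)%N ->
    ~ (u.2 = (p j).2 /\ forall k, (k < s j)%N ->
    (pset F u.1 (a k) <-> pset F (p j).1 (a k))).
  move=> n; apply: contrapT => nou; apply: non; exists n => u.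
  apply: contrapT => noj; apply: nou; exists u => j jn h; apply: noj; by exists j.
have [U [UU tailU]] := ultraFilterLemma (eventually_filter : ProperFilter \oo).
have PU : ProperFilter U by exact: ultra_proper.
(* a limit of uncovered traces *)
pose A : set I := [set i | (i < b)%O /\ U [set n | pset F (u n).1 i]].
have UA (i : I) : (i < b)%O -> U [set n | pset F (u n).1 i <-> A i].
  move=> ib; have [Ui|Ui] := in_ultra_setVsetC [set n | pset F (u n).1 i] UU.
    by apply: (filterS _ Ui) => n ni; split => [_|//]; split.
  apply: (filterS _ Ui) => n ni; split => // -[_ Ui'].
  by have [m [mi nmi]] := filter_ex (filterI Ui' Ui).
have Us (r : seq I) : (forall i, i \in r -> (i < b)%O) ->
    U [set n | forall i, i \in r -> (pset F (u n).1 i <-> A i)].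
  elim: r => [|i r IH] rb; first by apply: filterS filterT => n _.
  have /IH Ur : forall j, j \in r -> (j < b)%O by move=> j jr; apply: rb; rewrite inE jr orbT.
  have Ui := UA i (rb i (mem_head _ _)).
  by apply: filterS2 Ur Ui => n hr hi j; rewrite inE => /predU1P[->|/hr].
have [t tA] : exists t, pset F t = A.
  apply: (pset_closed om) => r.
  have [|n Hn] := filter_ex (Us [seq i <- r | (i < b)%O] _).
    by move=> i; rewrite mem_filter => /andP[].
  have [t _ tE] := pset_cut om F (u n).1 b; exists t => i ir; rewrite tE /=.
  have [ib|ib] := boolP (i < b)%O.
    have [|h1 h2] := Hn i; first by rewrite mem_filter ib ir.
    by split => [/h2|[/h1]].
  by split => [[ib' _]|[_ ib']]; case/negP: ib.
have [c Uc] : exists c, U [set n | (u n).2 = c].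
  have [h|h] := in_ultra_setVsetC [set n | (u n).2 = true] UU; first by exists true.
  by exists false; apply: filterS h => n /= /negP/negbTE.
have [t' t'b t'E] := pset_cut om F t b.
have [j pj] := psurj (t', c) t'b.
have Uj : U [set n | (j < n)%N] by apply: tailU; exists j.+1.
have Usj : U [set n | forall i, i \in map a (iota 0 (s j)) -> (pset F (u n).1 i <-> A i)].
  by apply: Us => i /mapP[k _ ->].
have [n [[/= h1 h2] h3]] := filter_ex (filterI (filterI Uc Uj) Usj).
apply: (Hu n j h2); rewrite pj; split => // k ks.
have ak : a k \in map a (iota 0 (s j)) by apply: map_f; rewrite mem_iota.
have := h3 _ ak; rewrite t'E tA /=; have := ab k; tauto.
Qed.

(** The functionals [q n] are the rational combinations of evaluations at the traces
    on an ordinal that decides all [u n]. *)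
Lemma separable_dual (u : nat -> X) : exists (P : set X) (q : nat -> X -> R),
  [/\ forall n, P (u n),
      forall x y, P x -> P y -> P (x - y),
      forall x, (forall e : R, 0 < e -> exists2 y, P y & supn (x - y) <= e) -> P x,
      forall n, (forall x y, q n (x + y) = q n x + q n y) /\
        exists2 C, 0 <= C & forall x, `|q n x| <= C * supn x
    & forall (L : W -> R) M, (forall g h, L (g + h) = L g + L h) ->
      (forall (a : R) g, L (a *: g) = a * L g) -> 0 <= M ->
      (forall g, L g <= M * supn g) -> forall e, 0 < e ->
      exists n, forall x, P x -> `|L (real_copy x) - q n x| <= e * supn x].
Proof.
have [b0 Hb0] := local_below om u.
have [b Hb] := omega1_bound om (countable1 b0).
have b0b := Hb b0 erefl.
have [_ _ below] := om.
have [a [ab asurj]] := countable_enum (below b) b0b.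
pose A : set (point I * bool) := [set v | points_below b v.1].
have cA : countable A.
  have -> : A = points_below b `*` [set: bool] by apply/seteqP; split => [v|v []].
  by apply: countableX => //; exact: countable_points_below.
have [p [pA psurj]] := countable_enum cA (lexx b : A (Seg b, true)).
pose Q (s : seq rat) x := \sum_(j < size s) ratr s`_j * real_copy x (p j).
exists (decided_below b), (fun n => Q (odflt [::] (unpickle n))); split.
- move=> n e e0; have [s [sb Hs]] := Hb0 n e e0; exists s; split => // i /sb ib.
  exact: lt_trans b0b.
- exact: decided_belowB.
- exact: decided_below_closed.
- move=> n; set s := odflt _ _; split.
    move=> x y; rewrite /Q -big_split; apply: eq_bigr => j _.
    by rewrite real_copyD ufunD mulrDr.
  exists (\sum_(j < size s) `|ratr s`_j|); first by apply: sumr_ge0.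
  move=> x; rewrite mulr_suml; apply: le_trans (ler_norm_sum _ _ _) _.
  apply: ler_sum => j _; rewrite normrM ler_wpM2l//.
  exact: le_trans (bfun_ge _ _) (real_copy_le _).
move=> L M LD LZ M0 LM e e0.
pose E j m : set (point I * bool) := [set v | v.2 = (p j).2 /\
  forall k, (k < m)%N -> (pset F v.1 (a k) <-> pset F (p j).1 (a k))].
have E_decr j m k : (m <= k)%N -> E j k `<=` E j m.
  move=> mk v [v2 Hv]; split => // i im; apply: Hv; exact: leq_trans mk.
have [s Hs] := @atomic_approx _ _ L M LD LZ M0 LM p E E_decr
  (trace_cover asurj ab psurj) e e0.
exists (pickle s) => x bx; rewrite pickleK /=.
apply: le_trans (Hs (real_copy x) _) _; last first.
  by rewrite ler_wpM2l ?real_copy_le// ltW.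
move=> j eta eta0; have [r [rb Hr]] := bx eta eta0.
have [m Hm] : exists m, forall i, i \in r -> exists2 k, (k < m)%N & a k = i.
  elim: r rb {Hr} => [|i r IH] rb; first by exists 0%N.
  have [m Hm] := IH (fun j jr => rb j (mem_behead (s := i :: r) jr)).
  have [k ak] := asurj i (rb i (mem_head _ _)).
  exists (maxn k.+1 m) => i'; rewrite inE => /predU1P[->|/Hm[k' k'm ak']].
    by exists k => //; rewrite leq_max leqnn.
  by exists k' => //; rewrite leq_max k'm orbT.
exists m => v [v2 Hv]; rewrite !real_copyE v2 -real_partB.
apply: le_trans (real_part_le _ _) _; apply: Hr => i /Hm[k km <-]; exact: Hv.
Qed.

End SeparableDual.

(** * Convex functions are generically Frechet differentiable *)

Section NestedBalls.
Variables (R : realType) (K : numFieldType) (S : scalars R K) (T : Type).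
Variable E : uspace S T.
Local Notation X := (uelt E).
Implicit Types (x y z : X).

Lemma supn_triangle x y z : supn (x - z) <= supn (x - y) + supn (y - z).
Proof. by rewrite -[x](subrK y) -[x - y + y - z]addrA addrK supnD. Qed.

(** Baire's theorem, with centres confined to a prescribed set. *)
Lemma nested_balls (D : set X) (P : nat -> X -> Prop) :
  (forall n c (r : R), D c -> 0 < r -> exists c' r', [/\ D c', 0 < r' &
    forall z, supn (z - c') <= r' -> supn (z - c) < r /\ P n z]) ->
  forall c (r : R), D c -> 0 < r -> exists z, [/\ supn (z - c) < r,
    forall n, P n z & forall e, 0 < e -> exists2 y, D y & supn (z - y) <= e].
Proof.
move=> step c0 r0 Dc0 r00.
have /choice[f Hf] : forall p : nat * (X * R), exists q : X * R,
    D p.2.1 -> 0 < p.2.2 -> [/\ D q.1, 0 < q.2, q.2 <= p.1.+1%:R^-1 &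
    forall z, supn (z - q.1) <= q.2 -> supn (z - p.2.1) < p.2.2 /\ P p.1 z].
  move=> [n [c r]] /=; have [[Dc r1]|no] := pselect (D c /\ 0 < r); last first.
    by exists (c, r) => Dc r1; case: no.
  have [c' [r' [Dc' r'0 H]]] := step n c r Dc r1.
  exists (c', Order.min r' n.+1%:R^-1) => _ _; split => //=.
  - by rewrite lt_min r'0 invr_gt0 ltr0n.
  - by rewrite ge_min lexx orbT.
  - by move=> z; rewrite le_min => /andP[/H].
pose b := fix b n : X * R := if n is n'.+1 then f (n', b n') else f (0%N, (c0, r0)).
have bD n : D (b n).1 /\ 0 < (b n).2.
  by elim: n => [|n [IH1 IH2]]; [have [] := Hf (0%N, (c0, r0)) Dc0 r00
    |have [] := Hf (n, b n) IH1 IH2].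
have bS n : (b n.+1).2 <= n.+1%:R^-1 /\ forall z, supn (z - (b n.+1).1) <= (b n.+1).2 ->
    supn (z - (b n).1) < (b n).2 /\ P n z.
  by have [IH1 IH2] := bD n; have [] := Hf (n, b n) IH1 IH2.
have b0 z : supn (z - (b 0%N).1) <= (b 0%N).2 -> supn (z - c0) < r0.
  by have [_ _ _ H] := Hf (0%N, (c0, r0)) Dc0 r00 => /H[].
have nest n k z : supn (z - (b (n + k)%N).1) <= (b (n + k)%N).2 ->
    supn (z - (b n).1) <= (b n).2.
  elim: k => [|k IH]; first by rewrite addn0.
  by rewrite addnS => /(bS _).2[/ltW/IH].
have bsmall e : 0 < e -> exists n0, forall n, (n0 <= n)%N -> (b n).2 <= e.
  move=> e0; have [k ke] := inv_natS_small e0; exists k.+1 => -[//|n] kn.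
  apply: le_trans (bS n).1 (le_trans _ ke).
  by rewrite lef_pV2 ?posrE// ler_nat.
have [l Hl] : exists l, forall n, supn ((b n).1 - l) <= 2 * (b n).2.
  apply: useq_complete => [e /bsmall[n0 ne]|n m /subnKC nm]; first by exists n0; exact: ne.
   rewrite supnC; apply: (nest n (m - n)%N).
  rewrite nm subrr -(re_unorm (0 : X)) normr0 raddf0; exact: ltW (bD m).2.
have lb n : supn (l - (b n).1) <= (b n).2.
  apply/ler_addgt0Pr => e e0; have [m0 me] := bsmall _ (divr_gt0 e0 (ltr0Sn R 1)).
  pose m := maxn m0 n; have nm : (n <= m)%N by exact: leq_maxr.
  have h1 := Hl m; have h2 := supn_triangle l (b m).1 (b n).1.
  have h3 : supn ((b m).1 - (b n).1) <= (b n).2.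
    apply: (nest n (m - n)%N); rewrite (subnKC nm) subrr.
    by rewrite -(re_unorm (0 : X)) normr0 raddf0 ltW// (bD m).2.
  have h4 := me m (leq_maxl _ _); rewrite supnC in h1; lra.
exists l; split.
- exact: b0 (lb 0%N).
- by move=> n; have [] := (bS n).2 l (lb n.+1).
- move=> e e0; have [n ne] := bsmall e e0; exists (b n).1; first exact: (bD n).1.
  exact: le_trans (lb n) (ne n _).
Qed.
End NestedBalls.

Section ConvexDifferentiability.
Variables (R : realType) (K : numFieldType) (S : scalars R K).
Variables (d : Order.disp_t) (I : orderType d) (om : is_omega1 I).
Variable F : coherent_family I.
Local Notation N := (modulus S).
Local Notation X := (system_space S (pset F)).
Local Notation W := (bfun R (point I * bool)%type).
Implicit Types (x y z h c : X).

Lemma supn_0 : supn (0 : X) = 0.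
Proof. by rewrite -re_unorm normr0 raddf0. Qed.

Lemma supn_emb (r : R) x : 0 <= r -> supn (emb S r *: x) = r * supn x.
Proof. by move=> r0; rewrite supnZ modulus_emb ger0_norm. Qed.

Variables (U : set X) (g : X -> R).
Hypothesis g_cont : forall x, U x -> forall e, 0 < e -> exists2 r, 0 < r &
  forall y, supn (y - x) < r -> U y /\ `|g y - g x| <= e.
Hypothesis g_conv : forall x y t, U x -> U y -> 0 <= t <= 1 ->
  g (emb S t *: x + emb S (1 - t) *: y) <= t * g x + (1 - t) * g y.

Lemma convex_comb_shift (t : R) x h1 h2 :
  x + (emb S t *: h1 + emb S (1 - t) *: h2) =
  emb S t *: (x + h1) + emb S (1 - t) *: (x + h2).
Proof.
by rewrite !scalerDr addrACA -scalerDl -rmorphD addrC [t + _]addrC subrK rmorph1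
  scale1r addrC.
Qed.

(** A convex function that is bounded above near [x] cannot decrease faster than
    linearly: [x] lies between [x + h] and a point on a fixed sphere. *)
Lemma convex_lower_bound x : U x -> exists r L, [/\ 0 < r, 0 <= L,
  forall h, supn h < r -> U (x + h) &
  forall h, supn h < r -> - (L * supn h) <= g (x + h) - g x].
Proof.
move=> Ux; have [r r0 Hr] := g_cont Ux ltr01.
pose r' := r / 2; have r'0 : 0 < r' by rewrite /r'; lra.
have UH h : supn h < r -> U (x + h).
  by move=> hr; apply: (Hr _ _).1; rewrite addrC addKr.
exists r', r'^-1; split => //; first by rewrite invr_ge0 ltW.
  by move=> h hr; apply: UH; rewrite /r' in hr; lra.
move=> h hr; have [h0|hn0] := eqVneq (supn h) 0.
  by rewrite (supn0_eq0 h0) supn_0 mulr0 addr0 subrr oppr0.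
have hp : 0 < supn h by rewrite lt_neqAle eq_sym hn0 supn_ge0.
pose k : R := r' / supn h; have k0 : 0 < k by rewrite divr_gt0.
pose h' : X := emb S (- k) *: h.
have h'r : supn h' < r.
  rewrite /h' rmorphN scaleNr supnN supn_emb ?ltW// /k divfK// /r'; lra.
pose t := k / (1 + k); have t01 : 0 <= t <= 1.
  rewrite /t; apply/andP; split; first by apply: divr_ge0; lra.
  by rewrite ler_pdivrMr; lra.
have xE : x = emb S t *: (x + h) + emb S (1 - t) *: (x + h').
  rewrite -convex_comb_shift /h' scalerA -rmorphM -scalerDl -rmorphD.
  have -> : t + (1 - t) * - k = 0 by rewrite /t; field; lra.
  by rewrite rmorph0 scale0r addr0.
have h_r : supn h < r by rewrite /r' in hr; lra.
have := g_conv (UH h h_r) (UH h' h'r) t01; rewrite -xE.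
have [_ /ler_normlP[_ gh']] : U (x + h') /\ `|g (x + h') - g x| <= 1.
  by apply: Hr; rewrite addrC addKr.
move=> gx; have tk : (1 - t) = t * (supn h / r').
  rewrite /t /k; field; do ?split; lra.
have t0 : 0 < t by rewrite divr_gt0//; lra.
have h1 : t * (g (x + h) - g x) >= - ((1 - t) * (g (x + h') - g x)) by lra.
have h2 : (1 - t) * (g (x + h') - g x) <= (1 - t) * 1.
  by rewrite ler_wpM2l//; case/andP: t01; lra.
rewrite -(ler_pM2l t0) mulrN; apply: le_trans h1; rewrite lerN2 (le_trans h2)//.
by rewrite mulr1 tk [r'^-1 * _]mulrC.
Qed.

(** The perspective of a convex function is subadditive: [h] is the average of [h1]
    and [h2] with weights proportional to [s1] and [s2]. *)
Lemma convex_perspective x (r s1 s2 : R) h1 h2 :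
  (forall h, supn h < r -> U (x + h)) -> 0 < s1 -> 0 < s2 ->
  supn h1 < r -> supn h2 < r ->
  exists h, [/\ supn h < r,
    (s1 + s2) *: real_copy h = s1 *: real_copy h1 + s2 *: real_copy h2 &
    (s1 + s2) * (g (x + h) - g x) <=
      s1 * (g (x + h1) - g x) + s2 * (g (x + h2) - g x)].
Proof.
move=> UH s10 s20 h1r h2r.
have s0 : 0 < s1 + s2 by rewrite addr_gt0.
have [t [t0 t1 tE1 tE2]] : exists t, [/\ 0 < t, 0 < 1 - t, (s1 + s2) * t = s1 &
    (s1 + s2) * (1 - t) = s2].
  have e : (s1 + s2) * (s1 / (s1 + s2)) = s1 by rewrite mulrC divfK ?gt_eqF.
  exists (s1 / (s1 + s2)); split => //.
  - by rewrite divr_gt0.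
  - by rewrite subr_gt0 ltr_pdivrMr// mul1r ltrDl.
  - by rewrite mulrBr e mulr1 addrC addKr.
exists (emb S t *: h1 + emb S (1 - t) *: h2); split.
- apply: le_lt_trans (supnD _ _) _; rewrite !supn_emb ?(ltW t0) ?(ltW t1)//.
  have a1 : t * supn h1 < t * r by rewrite ltr_pM2l.
  have a2 : (1 - t) * supn h2 < (1 - t) * r by rewrite ltr_pM2l.
  lra.
- by rewrite real_copyD !real_copyZ scalerDr !scalerA tE1 tE2.
rewrite convex_comb_shift.
have t01 : 0 <= t <= 1 by rewrite ltW//= -subr_ge0 ltW.
have := ler_wpM2l (ltW s0) (g_conv (UH _ h1r) (UH _ h2r) t01).
by rewrite mulrDr !mulrA tE1 tE2; lra.
Qed.

(** Hahn-Banach for the infimal convolution of the difference quotients of [g] with a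
    multiple of the sup norm. The functional lives on all bounded functions, where it
    can be multiplied by indicators as [atomic_approx] requires. *)
Lemma subgradient x : U x -> exists (L : W -> R) M,
  [/\ forall v w, L (v + w) = L v + L w, forall (a : R) v, L (a *: v) = a * L v,
      0 <= M, forall v, L v <= M * supn v
    & forall y, U y -> L (real_copy (y - x)) <= g y - g x].
Proof.
move=> Ux; have [r [L [r0 L0 UH Hg]]] := convex_lower_bound Ux.
(* the factor 2 comes from [real_copy_ge] *)
pose M := 2 * L; have M0 : 0 <= M by rewrite /M; lra.
pose v (w : W) : set R := [set c : R | exists s h, [/\ 0 < s, supn h < r &
  c = s * (g (x + h) - g x) + M * supn (w - s *: real_copy h)]].
have vlb w (c : R) : v w c -> - (M * supn w) <= c.
  move=> [s [h [s0 hr ->]]].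
  have h1 : - (s * (L * supn h)) <= s * (g (x + h) - g x).
    by rewrite -mulrN ler_pM2l// Hg.
  have h2 : s * (L * supn h) <= M * supn (s *: real_copy h).
    rewrite supnZ modulus_real gtr0_norm// /M.
    have := ler_wpM2l (mulr_ge0 (ltW s0) L0) (real_copy_ge h); lra.
  have h3 : supn (s *: real_copy h) <= supn w + supn (w - s *: real_copy h).
    have := supnD w (s *: real_copy h - w).
    have -> : w + (s *: real_copy h - w) = s *: real_copy h by rewrite addrC subrK.
    by rewrite [supn (s *: _ - w)]supnC.
  have h4 := ler_wpM2l M0 h3; rewrite mulrDr in h4; lra.
have vne w : v w (M * supn w).
  exists 1, 0; split => //; first by rewrite supn_0.
  rewrite addr0 subrr mulr0 add0r.
  suff -> : real_copy (0 : X) = 0 by rewrite scaler0 subr0.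
  by rewrite -(scale0r (0 : X)) -(rmorph0 (emb S)) real_copyZ scale0r.
have vinf w : has_inf (v w).
  by split; [exists (M * supn w)|exists (- (M * supn w)) => c; exact: vlb].
pose p w := inf (v w).
have ple w (c : R) : v w c -> p w <= c by move=> vc; apply: ge_inf => //; exact: (vinf w).2.
have pge w (c : R) : (forall c1 : R, v w c1 -> c <= c1) -> c <= p w.
  by move=> H; apply: lb_le_inf; [exact: (vinf w).1|exact: H].
have sp : sublinear p.
  split.
    move=> w1 w2; rewrite -lerBlDr; apply: (pge) => c1 [s1 [h1 [s10 h1r c1E]]].
    rewrite lerBlDr -lerBlDl; apply: (pge) => c2 [s2 [h2 [s20 h2r c2E]]].
    rewrite lerBlDl.
    have [h [hr hE hg]] := convex_perspective UH s10 s20 h1r h2r.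
    have vh : v (w1 + w2) ((s1 + s2) * (g (x + h) - g x) +
        M * supn (w1 + w2 - (s1 + s2) *: real_copy h)).
      by exists (s1 + s2), h; split => //; exact: addr_gt0.
    apply: le_trans (ple _ _ vh) _.
    have e1 : supn (w1 + w2 - (s1 + s2) *: real_copy h) <=
        supn (w1 - s1 *: real_copy h1) + supn (w2 - s2 *: real_copy h2).
      by rewrite hE opprD addrACA supnD.
    have := ler_wpM2l M0 e1; rewrite mulrDr c1E c2E; lra.
  have le t w : 0 < t -> p (t *: w) <= t * p w.
    move=> t0; rewrite -ler_pdivrMl//; apply: (pge) => c [s [h [s0 hr ->]]].
    rewrite ler_pdivrMl//; apply: ple; exists (t * s), h; split => //.
      by rewrite mulr_gt0.
    rewrite -scalerA -scalerBr supnZ modulus_real gtr0_norm//; ring.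
  move=> t w t0; apply: le_anti; rewrite le//=.
  have tn0 : t != 0 by rewrite gt_eqF.
  have wE : t^-1 *: (t *: w) = w by rewrite scalerA (mulVf tn0) scale1r.
  have ti0 : 0 < t^-1 by rewrite invr_gt0.
  by rewrite -ler_pdivlMl// -{1}wE; exact: le.
have [Lam [LD LZ Lp]] := sublinear_linear_minorant sp.
exists Lam, M; split => //.
  by move=> w; apply: le_trans (Lp w) (ple _ _ (vne w)).
have loc h : supn h < r -> Lam (real_copy h) <= g (x + h) - g x.
  move=> hr; apply: le_trans (Lp _) _; apply: ple; exists 1, h; split => //.
  by rewrite scale1r subrr mul1r -(re_unorm (0 : W)) normr0 raddf0 mulr0 addr0.
move=> y Uy; set h := y - x.
(* convexity carries the local inequality at [x + t h] to [y = x + h] *)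
pose t := Order.min 1 (r / (2 * (supn h + 1))).
have h1 : 0 < supn h + 1 by rewrite ltr_wpDl// supn_ge0.
have t0 : 0 < t by rewrite lt_min ltr01 divr_gt0// mulr_gt0.
have t1 : t <= 1 by rewrite ge_min lexx.
have thr : supn (emb S t *: h) < r.
  rewrite supn_emb ?ltW//; apply: (@le_lt_trans _ _ (r / (2 * (supn h + 1)) * supn h)).
    by rewrite ler_wpM2r ?supn_ge0// ge_min lexx orbT.
  rewrite mulrAC ltr_pdivrMr ?mulr_gt0// ltr_pM2l//; have := supn_ge0 h; lra.
have := loc _ thr; rewrite real_copyZ LZ => h2.
have xth : x + emb S t *: h = emb S t *: y + emb S (1 - t) *: x.
  by rewrite /h rmorphB rmorph1 scalerBl scale1r scalerBr addrCA.
have t01 : 0 <= t <= 1 by rewrite ltW.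
have := g_conv Uy Ux t01; rewrite -xth => h3.
by rewrite -(ler_pM2l t0); lra.
Qed.

End ConvexDifferentiability.

Section Asplund.
Variables (R : realType) (K : numFieldType) (S : scalars R K).
Variables (d : Order.disp_t) (I : orderType d) (om : is_omega1 I).
Variable F : coherent_family I.
Local Notation N := (modulus S).
Local Notation X := (system_space S (pset F)).
Local Notation W := (bfun R (point I * bool)%type).
Implicit Types (x y z h c : X).

Section GoodBalls.
Variables (U : set X) (g : X -> R).
Hypothesis g_cont : forall x, U x -> forall e, 0 < e -> exists2 r, 0 < r &
  forall y, supn (y - x) < r -> U y /\ `|g y - g x| <= e.
Hypothesis g_conv : forall x y t, U x -> U y -> 0 <= t <= 1 ->
  g (emb S t *: x + emb S (1 - t) *: y) <= t * g x + (1 - t) * g y.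

Definition second_difference x h := g (x + h) + g (x - h) - 2 * g x.

(** Second differences are controlled on a whole ball, not only at its centre, so that
    unions of good balls are open by definition. *)
Definition good_ball (e : R) c (r : R) : Prop :=
  [/\ 0 < r, forall x, supn (x - c) < r -> U x &
  forall x h, supn (x - c) < r -> supn (x + h - c) < r -> supn (x - h - c) < r ->
    second_difference x h <= e * supn h].

(** If a second difference at [x] exceeds [e * |h|], no functional [q] can be an
    approximate subgradient along both directions [h] and [- h]. *)
Lemma bad_direction (e : R) (q : X -> R) x h :
  (forall x y, q (x + y) = q x + q y) ->
  e * supn h < second_difference x h ->
  exists2 z, z = x + h \/ z = x - h &
    g x - g z < q (x - z) - e / 2 * supn (x - z).
Proof.
move=> qD bad; apply: contrapT => no.
have q0 : q 0 = 0 by have := qD 0 0; rewrite addr0; lra.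
have qN v : q (- v) = - q v by have := qD v (- v); rewrite subrr q0; lra.
have h1 : q (x - (x + h)) - e / 2 * supn (x - (x + h)) <= g x - g (x + h).
  by rewrite leNgt; apply/negP => lt; apply: no; exists (x + h) => //; left.
have h2 : q (x - (x - h)) - e / 2 * supn (x - (x - h)) <= g x - g (x - h).
  by rewrite leNgt; apply/negP => lt; apply: no; exists (x - h) => //; right.
have e1 : x - (x + h) = - h by rewrite opprD addNKr.
have e2 : x - (x - h) = h by rewrite opprB addrC subrK.
rewrite e1 qN supnN in h1; rewrite e2 in h2.
rewrite /second_difference in bad; lra.
Qed.

Lemma step_witness (e : R) x0 (r0 : R) : 0 < r0 ->
  (forall x, supn (x - x0) < r0 -> U x) ->
  (forall c r, supn (c - x0) < r0 -> ~ good_ball e c r) ->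
  forall c (k : nat), exists xh : X * X, supn (c - x0) < r0 ->
  [/\ supn (xh.1 - x0) < r0, supn (xh.1 + xh.2 - x0) < r0, supn (xh.1 - xh.2 - x0) < r0,
      [/\ supn (xh.1 - c) < k.+1%:R^-1, supn (xh.1 + xh.2 - c) < k.+1%:R^-1 &
      supn (xh.1 - xh.2 - c) < k.+1%:R^-1]
    & e * supn xh.2 < second_difference xh.1 xh.2].
Proof.
move=> r00 UB bad c k; have [cB|] := boolP (supn (c - x0) < r0); last first.
  by move=> _; exists (0, 0).
pose r := Order.min k.+1%:R^-1 (r0 - supn (c - x0)).
have rp : 0 < r by rewrite lt_min invr_gt0 ltr0n /= subr_gt0.
have rB x : supn (x - c) < r -> supn (x - c) < k.+1%:R^-1 /\ supn (x - x0) < r0.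
  rewrite lt_min => /andP[-> h1]; split => //.
  by have := supn_triangle x c x0; lra.
have {}bad := bad c r cB; apply: contrapT => no; apply: bad; split => //.
  by move=> x /rB[_ /UB].
move=> x h h1 h2 h3; rewrite leNgt; apply/negP => h4; apply: no; exists (x, h) => _ /=.
by have [? ?] := rB _ h1; have [? ?] := rB _ h2; have [? ?] := rB _ h3; split.
Qed.

(** Both sides of the inequality are continuous in [z], so its strict failure
    persists nearby. *)
Lemma violation_open (e C : R) (q : X -> R) x z : 0 < e ->
  (forall x y, q (x + y) = q x + q y) -> 0 <= C ->
  (forall x, `|q x| <= C * supn x) -> U z ->
  g x - g z < q (x - z) - e / 2 * supn (x - z) ->
  exists2 r, 0 < r & forall v, supn (v - z) <= r ->
    g x - g v < q (x - v) - e / 2 * supn (x - v).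
Proof.
move=> e0 qD C0 qC Uz zbad.
pose m := q (x - z) - e / 2 * supn (x - z) - (g x - g z).
have m0 : 0 < m by rewrite subr_gt0.
have m4 : 0 < m / 4 by rewrite divr_gt0.
have [r r0 Hr] := g_cont Uz m4; clear g_cont g_conv.
have C1 : 0 < C + 1 by rewrite ltr_wpDl.
exists (Order.min (r / 2) (Order.min (m / 4 / (C + 1)) (m / 4 / e))).
  by rewrite !lt_min !divr_gt0.
move=> v; rewrite !le_min => /and3P[v1 v2 v3].
have {}v2 : (C + 1) * supn (v - z) <= m / 4 by rewrite mulrC -ler_pdivlMr.
have {}v3 : e * supn (v - z) <= m / 4 by rewrite mulrC -ler_pdivlMr.
have [_ /ler_normlP[gv _]] : U v /\ `|g v - g z| <= m / 4.
  by apply: Hr; apply: le_lt_trans v1 _; rewrite ltr_pdivrMr// ltr_pMr// ltr1n.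
have e1 : x - v = (x - z) + - (v - z) by rewrite opprB addrA subrK.
have e2 : supn (x - v) <= supn (x - z) + supn (v - z).
  by rewrite e1; have := supnD (x - z) (- (v - z)); rewrite supnN.
have {}e2 := ler_wpM2l (ltW e0) e2.
have qv := qC (- (v - z)); rewrite supnN in qv; have {qv} /ler_normlP[qv _] := qv.
have nn := supn_ge0 (v - z).
rewrite {1}e1 qD; clear qD qC e1 Hr m4 zbad; rewrite /m in m0 v2 v3 gv.
move: e2 qv v2 v3 gv m0 nn; clear.
move: (q _) (q _) (g _) (g _) (g _) (supn _) (supn _) (supn _) => qa qb a b1 c1 sa sb sc.
lra.
Qed.

(** Density of the good balls. Otherwise a countable set [C], closed under taking
    witnesses of failure, lies in a piece with separable dual; killing one
    functional of a dense sequence at a time, nested balls centred in [C] lead to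
    a point without subgradient. *)
Lemma good_ball_dense (e : R) x0 (r0 : R) : 0 < e -> U x0 -> 0 < r0 ->
  exists c r, supn (c - x0) < r0 /\ good_ball e c r.
Proof.
move=> e0 Ux0 r00; have [r1 r10 Hr1] := g_cont Ux0 (ltr01).
pose rr := Order.min r0 r1; have rr0 : 0 < rr by rewrite lt_min r00.
apply: contrapT => nogood.
have UB x : supn (x - x0) < rr -> U x.
  by rewrite lt_min => /andP[_ /Hr1[]].
have bad c r : supn (c - x0) < rr -> ~ good_ball e c r.
  by rewrite lt_min => /andP[cr0 _] gb; apply: nogood; exists c, r.
have wit := step_witness rr0 UB bad.
have /choice[w Hw] : forall p : X * nat, exists xh : X * X, supn (p.1 - x0) < rr ->
  [/\ supn (xh.1 - x0) < rr, supn (xh.1 + xh.2 - x0) < rr, supn (xh.1 - xh.2 - x0) < rr,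
      [/\ supn (xh.1 - p.1) < p.2.+1%:R^-1, supn (xh.1 + xh.2 - p.1) < p.2.+1%:R^-1 &
      supn (xh.1 - xh.2 - p.1) < p.2.+1%:R^-1]
    & e * supn xh.2 < second_difference xh.1 xh.2].
  by move=> p; exact: wit.
pose node (o : nat * nat) c : X := let xh := w (c, o.1) in
  if o.2 is 0%N then xh.1 else if o.2 is 1%N then xh.1 + xh.2 else xh.1 - xh.2.
pose tree (s : seq (nat * nat)) : X := foldr node x0 s.
have treeB s : supn (tree s - x0) < rr.
  elim: s => [|[k i] s IH] /=; first by rewrite subrr supn_0.
  have [h1 h2 h3 _ _] := Hw (tree s, k) IH; rewrite /node.
  by case: i => [|[|i]]; [exact: h1|exact: h2|exact: h3].
have [P [q [Pu PB Pcl qP dualP]]] := separable_dual om (fun n => tree (odflt [::] (unpickle n))).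
have Ptree s : P (tree s) by have := Pu (pickle s); rewrite pickleK.
pose D := [set c | exists s, c = tree s].
pose kill n z := exists2 y, P y /\ U y & g y - g z < q n (y - z) - e / 2 * supn (y - z).
have step n c (r : R) : D c -> 0 < r -> exists c' r', [/\ D c', 0 < r' &
    forall z, supn (z - c') <= r' -> supn (z - c) < r /\ kill n z].
  move=> [s ->] r_gt0; have [k kr] := inv_natS_small r_gt0.
  have [h1 h2 h3 [h4 h5 h6] h7] := Hw (tree s, k) (treeB s).
  set x := (w (tree s, k)).1 in h1 h2 h3 h4 h5 h6 h7.
  set h := (w (tree s, k)).2 in h1 h2 h3 h4 h5 h6 h7.
  have [qD [C C0 qC]] := qP n.
  have [z zE zbad] := bad_direction qD h7.
  have xE : x = tree ((k, 0%N) :: s) by [].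
  have [s' zs'] : exists s', z = tree s'.
    by case: zE => ->; [exists ((k, 1%N) :: s)|exists ((k, 2%N) :: s)].
  have zr : supn (z - tree s) < r by case: zE => ->; exact: lt_le_trans kr.
  have Uz : U z by apply: UB; rewrite zs'; exact: treeB.
  have [r2 r20 Hr2] := violation_open e0 qD C0 qC Uz zbad.
  have rz : 0 < (r - supn (z - tree s)) / 2 by rewrite divr_gt0// subr_gt0.
  exists z, (Order.min r2 ((r - supn (z - tree s)) / 2)); split; first by exists s'.
    by rewrite lt_min r20.
  move=> v; rewrite le_min => /andP[v1 v2]; split.
    apply: le_lt_trans (supn_triangle v z (tree s)) _.
    rewrite -ltrBrDr; apply: le_lt_trans v2 _.
    by rewrite ltr_pdivrMr// ltr_pMr ?ltr1n// subr_gt0.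
  exists x; last exact: Hr2.
  by split; [rewrite xE; exact: Ptree|apply: UB].
have [z [zB zkill zlim]] := nested_balls step (ex_intro _ [::] erefl : D x0) rr0.
have Uz : U z := UB z zB.
have Pz : P z by apply: Pcl => eta /zlim[_ [s ->] zs]; exists (tree s).
have [L [M [LD LZ M0 LM Lz]]] := subgradient g_cont g_conv Uz.
have [n Hn] := dualP L M LD LZ M0 LM (e / 2) (divr_gt0 e0 (ltr0Sn R 1)).
have [y [Py Uy] ykill] := zkill n.
have /ler_normlP[hn1 hn2] := Hn (y - z) (PB _ _ Py Pz).
have := Lz y Uy; lra.
Qed.

(** The subgradient inequality along [- h] bounds the error along [h] from above. *)
Lemma second_difference_subgradient (L : W -> R) x h (e : R) :
  (forall v w, L (v + w) = L v + L w) -> (forall (a : R) v, L (a *: v) = a * L v) ->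
  (forall y, U y -> L (real_copy (y - x)) <= g y - g x) ->
  U (x + h) -> U (x - h) -> second_difference x h <= e * supn h ->
  `|g (x + h) - g x - L (real_copy h)| <= e * supn h.
Proof.
move=> LD LZ Lx U1 U2 sd.
have := Lx _ U1; have := Lx _ U2.
have -> : x + h - x = h by rewrite addrC addKr.
have -> : x - h - x = - h by rewrite addrC addKr.
rewrite real_copyN -scaleN1r LZ => h1 h2.
rewrite /second_difference in sd; rewrite ler_norml; lra.
Qed.

End GoodBalls.

(** A point lying in good balls for every [e] is a point of differentiability, any
    subgradient being the derivative; nested balls show that these points are dense. *)
Theorem asplund_space : asplund X.
Proof.
move=> U f oU cU fU cf fcont.
pose g x := re S (f x).
have fE x : U x -> f x = emb S (g x) by move=> Ux; rewrite /g real_emb//; exact: fU.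
have g_cont x : U x -> forall e, 0 < e -> exists2 r, 0 < r &
    forall y, supn (y - x) < r -> U y /\ `|g y - g x| <= e.
  move=> Ux e e0.
  have fx : {for x, continuous f}.
    by have := fcont; rewrite continuous_open_subspace// => /(_ x); apply; rewrite inE.
  have nU : nbhs x U by exact: open_nbhs_nbhs.
  have ne : nbhs x [set y | `|f x - f y| < emb S e].
    apply: (fx [set z | `|f x - z| < emb S e]); apply/nbhs_ballP.
    by exists (emb S e); [rewrite /= emb_gt0|move=> z].
  have : nbhs x (U `&` [set y | `|f x - f y| < emb S e]) by exact: filterI.
  move=> /nbhs_ballP[r /= r0 Hr].
  have rr0 := re_gt0 S r0.
  exists (re S r) => // y yx; have [|Uy fy] := Hr y.
    by apply/(uelt_ballP _ _ r0); rewrite supnC.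
  split => //; rewrite -(modulus_emb S) rmorphB -(fE _ Ux) -(fE _ Uy) modulusB.
  by rewrite modulus_le ltW.
have g_conv x y t : U x -> U y -> 0 <= t <= 1 ->
    g (emb S t *: x + emb S (1 - t) *: y) <= t * g x + (1 - t) * g y.
  move=> Ux Uy /andP[t0 t1].
  have T0 : 0 <= emb S t by rewrite emb_ge0.
  have T1 : emb S t <= 1 by rewrite -(rmorph1 (emb S)) emb_le.
  pose l : {i01 K} := Itv01 T0 T1.
  have h : f (emb S t *: x + (1 - emb S t) *: y) <=
      emb S t * f x + (1 - emb S t) * f y := cf l x y (mem_set Ux) (mem_set Uy).
  move/(re_homo S): h; rewrite (fE _ Ux) (fE _ Uy) -(rmorph1 (emb S)) -rmorphB.
  by rewrite -!rmorphM -rmorphD re_emb.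
pose O k := [set x | exists c r, good_ball U g k.+1%:R^-1 c r /\ supn (x - c) < r].
have Oopen k : open (O k).
  rewrite openE => x [c [r [gb xc]]].
  apply/nbhs_ballP; exists (emb S (r - supn (x - c))); first by rewrite /= emb_gt0 subr_gt0.
  move=> y xy; exists c, r; split => //.
  have r1 : 0 < emb S (r - supn (x - c)) by rewrite emb_gt0 subr_gt0.
  move/(uelt_ballP _ _ r1): xy; rewrite re_emb supnC => xy.
  have := supn_triangle y x c; clear r1; lra.
have OU k x : O k x -> U x by move=> [c [r [[_ Uc _] /Uc]]].
exists (\bigcap_k O k); split.
- by move=> x /(_ 0%N Logic.I)/OU.
- by exists O.
- move=> x Ux A /nbhs_ballP[e /= e0 eA]; have re0 := re_gt0 S e0.
  have step n c (r : R) : U c -> 0 < r -> exists c' r', [/\ U c', 0 < r' &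
      forall z, supn (z - c') <= r' -> supn (z - c) < r /\ O n z].
    move=> Uc r0; have n0 : 0 < n.+1%:R^-1 :> R by rewrite invr_gt0.
    have [c' [r' [c'c gb]]] := good_ball_dense g_cont g_conv n0 Uc r0.
    have [r'0 Ur' _] := gb.
    exists c', (Order.min (r' / 2) ((r - supn (c' - c)) / 2)); split.
    + by apply: Ur'; rewrite subrr supn_0.
    + by rewrite lt_min !divr_gt0// subr_gt0.
    move=> z; rewrite le_min => /andP[z1 z2]; split.
      by have := supn_triangle z c' c; lra.
    by exists c', r'; split => //; lra.
  have [z [zx zO _]] := nested_balls step Ux re0.
  exists z; split; first by move=> k _; exact: zO.
  by apply: eA; apply/(uelt_ballP _ _ e0); rewrite supnC.
move=> x Ox; have Ux : U x := OU 0%N x (Ox 0%N Logic.I).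
have [L [M [LD LZ M0 LM Lx]]] := subgradient g_cont g_conv Ux.
pose T h : K^o := emb S (L (real_copy h)).
have TD u v : T (u + v) = T u + T v by rewrite /T real_copyD LD rmorphD.
have LN v : L (- v) = - L v by rewrite -scaleN1r LZ mulN1r.
have Tle u : modulus S (T u) <= M * supn u.
  rewrite modulus_emb ler_norml lerNl -LN -real_copyN.
  have hM v : L (real_copy v) <= M * supn v.
    by apply: le_trans (LM _) _; rewrite ler_wpM2l ?real_copy_le.
  by rewrite hM andbT -[supn u]supnN hM.
exists T; split => //.
- by move=> t u tr; rewrite /T -{1}(real_emb S tr) real_copyZ LZ rmorphM real_emb.
- by move=> u; exact: emb_real.
- apply: (@additive_bounded_continuous _ _ S _ _ _ M) => // u v.
  by rewrite /T real_copyD real_copyN LD LN rmorphB.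
move=> e e0; have re0 := re_gt0 S e0.
have [k ke] := inv_natS_small re0.
have [c [r [[r0 Uc gb] xc]]] := Ox k Logic.I.
have rx : 0 < emb S (r - supn (x - c)) by rewrite emb_gt0 subr_gt0.
apply/nbhs_ballP; exists (emb S (r - supn (x - c))) => //= h.
move/(uelt_ballP _ _ rx); rewrite re_emb sub0r supnN => hr.
have xh1 : supn (x + h - c) < r.
  by have := supnD (x - c) h; rewrite addrAC; clear rx e0; lra.
have xh2 : supn (x - h - c) < r.
  by have := supnD (x - c) (- h); rewrite addrAC supnN; clear rx e0; lra.
have sd := second_difference_subgradient LD LZ Lx (Uc _ xh1) (Uc _ xh2) (gb x h xc xh1 xh2).
rewrite (fE _ (Uc _ xh1)) (fE _ Ux) -!rmorphB unormE -(emb_re S (ltW e0)) -rmorphM.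
rewrite -modulus_le modulus_emb (le_trans sd)// ler_wpM2r//; exact: supn_ge0.
Qed.

End Asplund.

(** * The two scalar fields *)

Section ComplexScalars.
Variable R : realType.
Local Open Scope complex_scope.

Definition complex_scalars : scalars R R[i].
Proof.
apply: (@Scalars R R[i] (real_complex R) (@complex.Re R) (@complex.Im R) 'i%C) => //=.
- by move=> x y; rewrite lecR.
- by move=> r [a b] /=; rewrite mul0r subr0.
- by move=> r [a b] /=; rewrite mul0r addr0.
- move=> [a b]; rewrite lecE /= => /andP[/eqP -> _] //.
- by move=> z; exact: complexE.
- by rewrite normc_def /= expr0n expr1n add0r sqrtr1.
- by move=> [a b]; rewrite /= -sqrtr_sqr ler_wsqrtr// lerDl sqr_ge0.
- by move=> [a b]; rewrite /= -sqrtr_sqr ler_wsqrtr// lerDr sqr_ge0.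
Defined.
End ComplexScalars.

Lemma asplund_auerbach_not_wcg (R : realType) (K : numFieldType) (S : scalars R K) :
  exists (d : Order.disp_t) (I : orderType d) (X : completeNormedModType K)
      (f : I -> X) (mu : I -> X -> K^o),
    is_omega1 I /\ asplund X /\
    auerbach_basis f mu /\ one_norming mu /\
    monotone_long_schauder_basis f /\ ~ weakly_compactly_generated X.
Proof.
have [d [I om]] := exists_omega1; have [F] := exists_coherent_family om.
exists d, I, (system_space S (pset F)), (basis_vec S F), (@basis_coef _ _ S _ _ F).
split; first exact: om.
split; first exact: asplund_space.
split; first exact: auerbach.
split; first exact: one_norming_basis.
split; first exact: monotone_basis.
exact: not_wcg.
Qed.

Local Open Scope complex_scope.

Theorem theorem4p7 (R : realType) :
  (exists (d : Order.disp_t) (I : orderType d) (X : completeNormedModType R)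
      (f : I -> X) (mu : I -> X -> R^o),
    is_omega1 I /\ asplund X /\
    auerbach_basis f mu /\ one_norming mu /\
    monotone_long_schauder_basis f /\ ~ weakly_compactly_generated X)
  /\
  (exists (d : Order.disp_t) (I : orderType d) (X : completeNormedModType R[i])
      (f : I -> X) (mu : I -> X -> R[i]^o),
    is_omega1 I /\ asplund X /\
    auerbach_basis f mu /\ one_norming mu /\
    monotone_long_schauder_basis f /\ ~ weakly_compactly_generated X).
Proof.
split; first exact: asplund_auerbach_not_wcg (real_scalars R).
exact: asplund_auerbach_not_wcg (complex_scalars R).
Qed.
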